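(* Consider Radix Selection using $b\ge 2$ buckets under the Markov source model. (i) For all $v\in\Sigma^\infty$ and all $\Sigma^\infty$-valued (deterministic) sequences $(v(n))_{n\ge1}$ with $j(v(n),v)\to\infty$, we have, almost surely and with respect to all moments, as $n\to\infty$, $$\frac{Z_n(v(n))}{n}\to m(v).$$ (ii) For $k=k(n)\in\{1,\ldots,n\}$ with $k/n\to t\in[0,1]\setminus F(\Sigma_0^\infty)$, we have, almost surely and with respect to all moments, as $n\to\infty$, $$\frac{Y_n(k)}{n}\to m(h(t)).$$
   Context: Let $b\ge 2$ be an integer, $\Sigma=\{0,\ldots,b-1\}$, $\Sigma^\infty$ the set of infinite strings over $\Sigma$, and $\Sigma^*=\bigcup_{n\ge 0}\Sigma^n$ with $\Sigma^0=\{\emptyset\}$. Markov source model: a homogeneous Markov chain on $\Sigma$ with initial distribution $\mu=(\mu_r)_{r\in\Sigma}$ and transition matrix $(p_{ij})_{i,j\in\Sigma}$, where always $0<\mu_i,p_{ij}<1$ for all $i,j\in\Sigma$. $S_1,S_2,\ldots$ are independent infinite strings, each generated by this chain. For $v,w\in\Sigma^\infty$, $j(v,w)=\max\{i\ge 0:(v_1,\ldots,v_i)=(w_1,\ldots,w_i)\}$ ($=\infty$ if $v=w$); $v<w$ means $v_{j(v,w)+1}<w_{j(v,w)+1}$ (lexicographic order), and $v\le w$ means $v<w$ or $v=w$. $S_{(1)}<\cdots<S_{(n)}$ are the order statistics of $S_1,\ldots,S_n$ (a.s. distinct). $\Lambda_{n,k}(v)=\#\{1\le i\le n: j(v,S_i)\ge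 k\}$ for $k\ge0$; $Z_n(v)=\sum_{k\ge 0}\Lambda_{n,k}(v)\mathbf 1_{\{\Lambda_{n,k}(v)>1\}}$ for $v\in\Sigma^\infty$; and $Y_n(\ell)=Z_n(S_{(\ell)})$, $1\le\ell\le n$ (the number of bucket operations Radix Selection needs to retrieve the element of rank $\ell$ in $\{S_1,\ldots,S_n\}$). For $v=v_1\ldots v_k\in\Sigma^*$ with $k\ge1$, $\pi(v)=\mu_{v_1}p_{v_1v_2}\cdots p_{v_{k-1}v_k}$, and $\pi(\emptyset)=1$. Write $v\preceq w$ if $v\in\Sigma^*$ is a prefix of $w$. Then $m(w)=\sum_{v\preceq w,\,v\in\Sigma^*}\pi(v)$ and $F(w)=\mathbb P(S_1\le w)$ for $w\in\Sigma^\infty$, and $h(t)=\sup\{v\in\Sigma^\infty:F(v)\le t\}$ for $t\in[0,1]$ (supremum in lexicographic order). $\Sigma_0^\infty$ is the set of infinite strings with a finite and non-zero number of entries different from $0$. ''Almost surely and with respect to all moments'' means almost sure convergence together with convergence of the $p$-th moments for every $p\in\mathbb N$. *)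

(* Defs.v *)
From HB Require Import structures.
From mathcomp Require Import all_boot all_order all_algebra.
From mathcomp Require Import all_classical all_reals all_analysis.
Set Implicit Arguments.
Unset Strict Implicit.
Unset Printing Implicit Defensive.
Import Order.TTheory GRing.Theory Num.Theory numFieldNormedType.Exports.
Local Open Scope classical_set_scope.
Local Open Scope ring_scope.

(** Letters, strings and ranks of strings.

   Infinite strings are indexed from 0: the letter written v_(k+1) in the usual
   one-based convention is [v k].  Likewise [S i] is the (i+1)-st string. *)
Definition istr (b : nat) : Type := nat -> 'I_b.

Definition agree b (k : nat) (v w : istr b) : Prop :=
  forall l, (l < k)%N -> v l = w l.

(** [Some j] with [j] the largest length of a common prefix, [None] for
   infinity.  The default value 0 of [xget] is never used: by [lcp_spec] below
   the maximum exists when [v <> w]. *)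
Definition lcp b (v w : istr b) : option nat :=
  if `[< v = w >] then None
  else Some (xget 0%N [set i | agree i v w /\
                        forall i', agree i' v w -> (i' <= i)%N]).

Definition len_ge (k : nat) (j : option nat) : bool :=
  if j is Some i then (k <= i)%N else true.

Definition len_to_infty (j : nat -> option nat) : Prop :=
  forall K : nat, \forall n \near \oo, len_ge K (j n).

Definition lex_lt b (v w : istr b) : Prop :=
  exists2 i, lcp v w = Some i & (v i < w i)%N.

Definition lex_le b (v w : istr b) : Prop := lex_lt v w \/ v = w.

Definition lex_leb b (v w : istr b) : bool := `[< lex_le v w >].

Definition zero_letter b (hb : (1 < b)%N) : 'I_b := Ordinal (ltnW hb).

Definition lex_lub b (A : set (istr b)) (u : istr b) : Prop :=
  (forall v, A v -> lex_le v u) /\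
  (forall u', (forall v, A v -> lex_le v u') -> lex_le u u').

(** The default value of [xget] is never used: every set of strings has a
   least upper bound. *)
Definition lex_sup b (hb : (1 < b)%N) (A : set (istr b)) : istr b :=
  xget (fun=> zero_letter hb) [set u | lex_lub A u].

Definition Sigma0 b : set (istr b) :=
  [set v | finite_set [set k | nat_of_ord (v k) != 0%N] /\
           [set k | nat_of_ord (v k) != 0%N] !=set0].

(** Markov sources. *)
Definition markov_parameters (R : realType) b
    (mu : 'I_b -> R) (p : 'I_b -> 'I_b -> R) : Prop :=
  [/\ forall r, 0 < mu r < 1, \sum_r mu r = 1,
      forall i j, 0 < p i j < 1 & forall i, \sum_j p i j = 1].

(** [X] is a homogeneous Markov chain; the one-step property is
   P(X_(n+1) = j | X_0 = v_0, ..., X_n = v_n) = p_(v_n, j), multiplied out. *)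
Definition markov_chain d (Om : measurableType d) (R : realType)
    (P : probability Om R) b (mu : 'I_b -> R) (p : 'I_b -> 'I_b -> R)
    (X : Om -> istr b) : Prop :=
  [/\ forall k r, measurable [set om | X om k = r],
      forall r, P [set om | X om 0%N = r] = (mu r)%:E &
      forall n (v : istr b) j,
        P [set om | agree n.+1 (X om) v /\ X om n.+1 = j] =
        (P [set om | agree n.+1 (X om) v] * (p (v n) j)%:E)%E].

Definition sigma_of_string (Om : Type) b (X : Om -> istr b) : set (set Om) :=
  <<s [set A | exists k r, A = [set om | X om k = r]] >>.

Definition independent_strings d (Om : measurableType d) (R : realType)
    (P : probability Om R) b (S : nat -> Om -> istr b) : Prop :=
  forall (J : seq nat) (A : nat -> set Om), uniq J ->
    (forall i, i \in J -> sigma_of_string (S i) (A i)) ->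
    P (\bigcap_(i in [set` J]) A i) = (\prod_(i <- J) P (A i))%E.

Fixpoint trans_weight (R : realType) b (p : 'I_b -> 'I_b -> R)
    (r : 'I_b) (v : seq 'I_b) : R :=
  if v is s :: v' then p r s * trans_weight p s v' else 1.

Definition word_weight (R : realType) b (mu : 'I_b -> R)
    (p : 'I_b -> 'I_b -> R) (v : seq 'I_b) : R :=
  if v is r :: v' then mu r * trans_weight p r v' else 1.

Definition is_prefix b (v : seq 'I_b) (w : istr b) : Prop :=
  mkseq w (size v) = v.

Definition prefix_mass (R : realType) b (mu : 'I_b -> R)
    (p : 'I_b -> 'I_b -> R) (w : istr b) : \bar R :=
  \esum_(v in [set v | is_prefix v w]) (word_weight mu p v)%:E.

Definition string_cdf d (Om : measurableType d) (R : realType)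
    (P : probability Om R) b (X : Om -> istr b) (w : istr b) : R :=
  fine (P [set om | lex_le (X om) w]).

Definition string_quantile d (Om : measurableType d) (R : realType)
    (P : probability Om R) b (hb : (1 < b)%N) (X : Om -> istr b) (t : R) :
    istr b :=
  lex_sup hb [set v | string_cdf P X v <= t].

(** Radix Selection. *)
Definition Lambda (Om : Type) b (S : nat -> Om -> istr b) (n k : nat)
    (v : istr b) (om : Om) : nat :=
  #|[set i : 'I_n | len_ge k (lcp v (S i om))]|.

(** Extended-real valued: [Z] is infinite where two of the strings coincide with
   [v], which is a null event for the strings considered. *)
Definition Z (R : realType) (Om : Type) b (S : nat -> Om -> istr b) (n : nat)
    (v : istr b) (om : Om) : \bar R :=
  (\sum_(0 <= k <oo)
     (if (1 < Lambda S n k v om)%N then (Lambda S n k v om)%:R else 0)%:E)%E.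

(** The string of rank [l], for [1 <= l <= n], among the first [n] strings. *)
Definition order_stat (Om : Type) b (S : nat -> Om -> istr b) (n l : nat)
    (om : Om) : istr b :=
  nth (S 0%N om) (sort (@lex_leb b) [seq S i om | i <- iota 0 n]) l.-1.

Definition Y (R : realType) (Om : Type) b (S : nat -> Om -> istr b) (n l : nat)
    (om : Om) : \bar R :=
  Z R S n (order_stat S n l om) om.

Definition cvg_as_and_moments d (Om : measurableType d) (R : realType)
    (P : probability Om R) (X : nat -> Om -> \bar R) (x : \bar R) : Prop :=
  {ae P, forall om, X n om @[n --> \oo] --> x} /\
  forall q : nat,
    (\int[P]_om (X n om ^+ q))%E @[n --> \oo] --> (x ^+ q)%E.

Lemma lcp_spec b (v w : istr b) k : len_ge k (lcp v w) <-> agree k v w.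
Proof.
rewrite /lcp; case: asboolP => [->|vw] //=.
have [i0 vwi0] : exists i, v i != w i.
  apply: contrapT => H; apply: vw; apply/funext => i; apply/eqP.
  by apply: contrapT => /negP Hi; apply: H; exists i.
have ex : exists i, v i != w i by exists i0.
case: (ex_minnP ex) => i vwi imin.
have agi : agree i v w.
  move=> l li; apply/eqP; rewrite -[_ == _]negbK; apply/negP => /imin.
  by rewrite leqNgt li.
have mx i' : agree i' v w -> (i' <= i)%N.
  by move=> H; rewrite leqNgt; apply/negP => /H /eqP; exact/negP.
case: xgetP => [j _ [agj jmax]|/(_ i) []]; last by split.
split=> [kj l lk|]; last exact: jmax.
by apply: agj; apply: leq_trans lk kj.
Qed.

(* Main.v *)
Require Import Defs.
From HB Require Import structures.
From mathcomp Require Import all_boot all_order all_algebra.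
From mathcomp Require Import all_classical all_reals all_analysis.
From mathcomp Require Import measurable_realfun ring lra.
Set Implicit Arguments.
Unset Strict Implicit.
Unset Printing Implicit Defensive.
Import Order.TTheory GRing.Theory Num.Theory numFieldNormedType.Exports.
Local Open Scope classical_set_scope.
Local Open Scope ring_scope.

(** [Z n v] adds, over all lengths [k], the number of sample strings sharing a
   prefix of length [k] with [v], as long as this number is at least 2. For a
   fixed [k] the law of large numbers makes this number, divided by [n], tend to
   the weight of the prefix, and [m(v)] is the sum of these weights; what has to
   be justified is the exchange of the limit with the sum over [k]. In the
   second part [v] is itself a random string of the sample, so the justification
   must be uniform over all strings.

   Let [N w] be the number of the first [n] strings that start with a word [w]
   of length [k]. The weights of these words add up to 1 and are at most
   [C * r ^ (16 * k)]. The probability that [2 <= N w] and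
   [n * r ^ (2 * k) <= `|N w - n * weight w|] for some [w] of length [k] has two
   bounds: [1 / (n * r ^ (4 * k))] by Chebyshev's inequality, and
   [C * n ^ 2 * r ^ (16 * k)] for two hits to occur at all. The first is small
   for large [n], the second for large [k], and their weighted geometric mean is
   a constant times [n ^ (-1/4) * r ^ k]. This is summable over [k] and over the
   eighth powers [n], so by Borel and Cantelli, and by monotonicity in [n]
   between eighth powers, almost surely all counts [N w] that are at least 2 are
   at most a constant times [n * r ^ (2 * k)] from some [n] on
   ([ae_geometric_tail]). This geometric bound dominates the series of
   [Z n v / n] and gives the almost sure limit by Tannery's theorem
   ([scaled_Z_cvg]).

   For the moments it is enough that every moment of [Z n v / n] is bounded
   uniformly in [n] ([moments_cvg]). The summands of [Z n v / n] lie in [0, 1],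
   so a power of their sum is at most a linear combination of the summands with
   coefficients polynomial in [k] ([expr_sum_le]); and the squares of the
   summands are controlled by the number of pairs of sample strings sharing a
   prefix of length [k], whose expectation decays geometrically
   ([scaled_Z_moment_bound]).

   All this holds for any random strings [V n] that share longer and longer
   prefixes with a fixed string ([random_string_cvg]); the first part is the
   case of deterministic [V n]. In the second part [V n] is the string of rank
   [k n]. Choosing letters greedily gives the largest string whose distribution
   function is at most [t], and this is the quantile [h(t)]. Its prefixes ending
   in a nonzero letter, continued by zeros, and the strings obtained by raising
   a letter of it and continuing by zeros are thresholds: by the law of large
   numbers the proportion of the sample below a threshold tends to the value of
   the distribution function there. This value is larger than [t] for a raised
   letter by the greedy choice, and less than [t] for a prefix because [t] is
   not in the image of [Sigma0]. As [k n / n] tends to [t], the string of rank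
   [k n] eventually lies between the thresholds of any given length, and so
   shares longer and longer prefixes with [h(t)] ([order_stat_agree]). *)

(** * First and second moments of the number of hits *)

Lemma markov_inequality d (Om : measurableType d) (R : realType)
  (P : probability Om R) (f : Om -> R) (B : set Om) (e C : R) :
  0 < e -> measurable B -> measurable_fun setT f -> (forall om, 0 <= f om) ->
  (forall om, B om -> e <= f om) -> (\int[P]_om (f om)%:E <= C%:E)%E ->
  (P B <= (C / e)%:E)%E.
Proof.
move=> e0 mB mf f0 Be fC.
rewrite EFinM lee_pdivlMr// muleC; apply: le_trans fC.
rewrite -[B in P B]setIT -integral_indic// -ge0_integralZl_EFin//;
  last exact: ltW.
  apply: ge0_le_integral => //.
  - by move=> om _; rewrite -EFinM lee_fin mulr_ge0// ?ltW// indicE.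
  - by apply: measurable_funeM; apply/measurable_EFinP/measurable_indic.
  - exact/measurable_EFinP.
  - move=> om _; rewrite -EFinM lee_fin indicE.
    case: (boolP (om \in B)) => [/set_mem/Be|_]; first by rewrite mulr1.
    by rewrite mulr0.
- by apply/measurable_EFinP/measurable_indic.
Qed.

Definition hits (R : realType) (Om : Type) (A : nat -> set Om) (n : nat)
    (om : Om) : R := \sum_(i < n) \1_(A i) om.

Section hits_basic.
Context (R : realType) (Om : Type).
Implicit Types (A : nat -> set Om) (n : nat) (om : Om).

Lemma hits_ge0 A n om : 0 <= hits R A n om.
Proof. by apply: sumr_ge0 => i _; rewrite indicE. Qed.

Lemma hits_nat A n om : hits R A n om = (\sum_(i < n) (om \in A i : nat))%:R.
Proof. by rewrite natr_sum; apply: eq_bigr => i _; rewrite indicE. Qed.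

Lemma hits_le A n om : hits R A n om <= n%:R.
Proof.
rewrite hits_nat ler_nat -[leqRHS](card_ord n) -sum1_card.
by apply: leq_sum => i _; case: (_ \in _).
Qed.

Lemma hits_mono A n m om : (n <= m)%N -> hits R A n om <= hits R A m om.
Proof.
move=> nm; rewrite /hits (big_ord_widen _ (fun i => \1_(A i) om : R) nm).
rewrite [leRHS](bigID (fun i : 'I_m => (i < n)%N)) /= lerDl.
by apply: sumr_ge0 => i _; rewrite indicE.
Qed.

Lemma hits_pairs_ge0 A n om : 0 <= hits R A n om * (hits R A n om - 1).
Proof.
rewrite hits_nat; case: (\sum_(i < n) _)%N => [|m]; first by rewrite mul0r.
by rewrite mulr_ge0// -natr1 addrK.
Qed.

End hits_basic.

Section hits_moments.
Context d (Om : measurableType d) (R : realType) (P : probability Om R).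
Variables (A : nat -> set Om) (c : R).
Hypothesis mA : forall i, measurable (A i).
Hypothesis PA : forall i, P (A i) = c%:E.
Hypothesis PAA : forall i j, i != j -> P (A i `&` A j) = (c ^+ 2)%:E.

Let c0 : 0 <= c. Proof. by rewrite -lee_fin -(PA 0%N). Qed.

Let PAm i : (P : {measure set Om ->
  \bar R}) (A i) = c%:E. Proof. exact: PA. Qed.

Let PAAm i j : i != j ->
  (P : {measure set Om -> \bar R}) (A i `&` A j) = (c ^+ 2)%:E.
Proof. exact: PAA. Qed.

Lemma measurable_hits n : measurable_fun setT (hits R A n).
Proof. by apply: measurable_sum => i; apply: measurable_indic. Qed.

Lemma integral_hits n : (\int[P]_om (hits R A n om)%:E = (n%:R * c)%:E)%E.
Proof.
under eq_integral do rewrite /hits -sumEFin.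
rewrite ge0_integral_sum//.
- under eq_bigr do rewrite integral_indic// setIT PAm.
  by rewrite sumEFin sumr_const card_ord mulr_natl.
- by move=> i; apply/measurable_EFinP; exact: measurable_indic.
Qed.

Lemma integral_hits_sqr n : (\int[P]_om (hits R A n om ^+ 2)%:E
  = (n%:R * c + n%:R * (n%:R - 1) * c ^+ 2)%:E)%E.
Proof.
have E om : (hits R A n om ^+ 2)%:E =
    (\sum_(i < n) \sum_(j < n) (\1_(A i `&` A j) om)%:E)%E.
  rewrite expr2 /hits big_distrlr/= -sumEFin; apply: eq_bigr => i _.
  by rewrite -sumEFin; apply: eq_bigr => j _; rewrite indicI.
under eq_integral do rewrite E.
have m2 i j : measurable_fun setT (fun om => (\1_(A i `&` A j) om : R)%:E).
  by apply/measurable_EFinP/measurable_indic/measurableI.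
rewrite ge0_integral_sum//; last first.
- by move=> i om _; apply: sume_ge0 => j _; rewrite lee_fin indicE.
- by move=> i; exact: emeasurable_sum.
have row (i : 'I_n) : (\int[P]_om (\sum_(j < n) (\1_(A i `&` A j) om)%:E)
    = (c + n.-1%:R * c ^+ 2)%:E)%E.
  rewrite ge0_integral_sum// (bigD1 i)//= integral_indic//;
    last exact: measurableI.
  rewrite setIid setIT PAm EFinD; congr (_ + _)%E.
  transitivity (\sum_(j < n | j != i) (c ^+ 2)%:E)%E.
    apply: eq_bigr => j ji; rewrite integral_indic//; last exact: measurableI.
    by rewrite setIT PAAm// eq_sym.
  rewrite sumEFin sumr_const mulr_natl.
  by rewrite (@eq_card _ _ (predC1 i)) ?cardC1 ?card_ord.
under eq_bigr do rewrite row.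
rewrite sumEFin sumr_const card_ord -mulr_natl; congr EFin.
case: n E row => [|n] _ _; first by rewrite !mul0r add0r.
by rewrite /= -natr1; ring.
Qed.

(** Counting ordered pairs of distinct hits removes the term linear in [c].
   Summed over all words of length [k] the weights give 1, but their squares
   decay geometrically in [k]. *)
Lemma integral_hits_pairs n :
  (\int[P]_om (hits R A n om * (hits R A n om - 1))%:E
   = (n%:R * (n%:R - 1) * c ^+ 2)%:E)%E.
Proof.
set I := LHS.
have m1 := measurable_hits n.
have : (I + (n%:R * c)%:E = (n%:R * c + n%:R * (n%:R - 1) * c ^+ 2)%:E)%E.
  rewrite -integral_hits_sqr -integral_hits -ge0_integralD//.
  - by apply: eq_integral => om _; rewrite -EFinD; congr EFin; ring.
  - by move=> om _; rewrite lee_fin hits_pairs_ge0.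
  - apply/measurable_EFinP; apply: measurable_funM => //.
    exact: measurable_funB.
  - by move=> om _; rewrite lee_fin hits_ge0.
  - exact/measurable_EFinP.
move: I => [r| |]//= [/(canRL (addrK _)) ->]; congr EFin; ring.
Qed.

Lemma integral_hits_variance n :
  (\int[P]_om ((hits R A n om - n%:R * c) ^+ 2)%:E <= (n%:R * c)%:E)%E.
Proof.
set I := (X in (X <= _)%E).
have m1 := measurable_hits n.
have : (I + (2 * n%:R * c * (n%:R * c))%:E =
    (n%:R * c + n%:R * (n%:R - 1) * c ^+ 2 + (n%:R * c) ^+ 2)%:E)%E.
  rewrite [in LHS]EFinM -integral_hits -ge0_integralZl_EFin//; last first.
  - by rewrite !mulr_ge0.
  - exact/measurable_EFinP.
  - by move=> om _; rewrite lee_fin hits_ge0.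
  rewrite -ge0_integralD//; last first.
  - by apply/measurable_EFinP; exact: measurable_funM.
  - by move=> om _; rewrite lee_fin !mulr_ge0// hits_ge0.
  - apply/measurable_EFinP; apply: measurable_funX; exact: measurable_funB.
  - by move=> om _; rewrite lee_fin sqr_ge0.
  rewrite [in RHS]EFinD -integral_hits_sqr.
  have -> : ((n%:R * c) ^+ 2)%:E = (\int[P]_om ((n%:R * c) ^+ 2)%:E)%E.
    by rewrite integral_cst//= probability_setT mule1.
  rewrite -ge0_integralD//.
  - by apply: eq_integral => om _; rewrite -!EFinM -!EFinD; congr EFin; ring.
  - by move=> om _; rewrite lee_fin sqr_ge0.
  - by apply/measurable_EFinP; exact: measurable_funX.
  - by move=> om _; rewrite lee_fin sqr_ge0.
move: I => [r| |]//= [E]; rewrite lee_fin.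
have -> : r = n%:R * c - n%:R * c ^+ 2.
  by apply: (addIr (2 * n%:R * c * (n%:R * c))); rewrite E; ring.
by rewrite lerBlDr lerDl mulr_ge0// sqr_ge0.
Qed.

Lemma hits_deviation n (e : R) : 0 < e ->
  (P [set om | (e <= `|hits R A n om - n%:R * c|)%R] <= (n%:R * c / e ^+
    2)%:E)%E.
Proof.
move=> e0; have mD := measurable_funB (measurable_hits n) (measurable_cst (n%:R
  * c)).
apply: (@markov_inequality _ _ _ _ (fun om => (hits R A n om - n%:R * c) ^+ 2)).
- by rewrite exprn_gt0.
- rewrite -[X in measurable X]setTI; apply: measurable_fun_le => //.
  exact: measurableT_comp.
- exact: measurable_funX.
- by move=> om; exact: sqr_ge0.
- by move=> om /= h; rewrite -[leRHS]real_normK ?num_real// lerXn2r ?nnegrE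
    ?normr_ge0// ltW.
- exact: integral_hits_variance.
Qed.

Lemma measurable_hits_ge n (x : R) : measurable [set om | x <= hits R A n om].
Proof.
rewrite -[X in measurable X]setTI; apply: measurable_fun_le => //.
exact: measurable_hits.
Qed.

Lemma two_hits n : (P [set om | (2 <= hits R A n om)%R] <= (n%:R ^+ 2 * c ^+
  2)%:E)%E.
Proof.
rewrite -[leRHS]mule1 -[X in (_ * X)%E](_ : (1^-1)%:E = 1%E);
  last by rewrite invr1.
have mh := measurable_hits n.
apply: (@markov_inequality _ _ _ _ (fun om =>
  hits R A n om * (hits R A n om - 1))) => //.
- exact: measurable_hits_ge.
- by apply: measurable_funM => //; exact: measurable_funB.
- exact: hits_pairs_ge0.
- by move=> om /= h; nra.
- rewrite integral_hits_pairs lee_fin ler_wpM2r// ?sqr_ge0// expr2.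
  by rewrite ler_wpM2l// gerBl.
Qed.

End hits_moments.

(** * The strong law for pairwise independent events *)

Lemma sum_geometric_le (R : realType) (r a : R) n : 0 < r < 1 -> 0 <= a ->
  \sum_(k < n) a * r ^+ k <= a / (1 - r).
Proof.
move=> /andP[r0 r1] a0; rewrite -mulr_sumr ler_wpM2l//.
rewrite -[leRHS]mul1r ler_pdivlMr ?subr_gt0// mulrC.
have := subrXX 1 r n; rewrite expr1n => H.
have -> : \sum_(k < n) r ^+ k = \sum_(i < n) 1 ^+ (n.-1 - i) * r ^+ i.
  by apply: eq_bigr => i _; rewrite expr1n mul1r.
by rewrite -H gerBl exprn_ge0// ltW.
Qed.

Lemma sum_inv_square_le (R : realType) (n : nat) :
  \sum_(m < n) (m.+1%:R ^- 2) <= 2 - 2 / n.+1%:R :> R.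
Proof.
elim: n => [|n IH]; first by rewrite big_ord0 divr1 subrr.
rewrite big_ord_recr/= (le_trans (lerD IH (lexx _)))//.
rewrite -addrA lerD2l -subr_ge0.
have -> : - (2 / n.+2%:R) - (- (2 / n.+1%:R) + n.+1%:R ^- 2) =
    (n%:R / (n.+1%:R ^+ 2 * n.+2%:R)) :> R.
  rewrite -[n.+2%:R]natr1 -[n.+1%:R]natr1; field.
  by rewrite !natr1 !pnatr_eq0.
by rewrite divr_ge0// mulr_ge0// sqr_ge0.
Qed.

Lemma nneseries_le_bound (R : realType) (u : nat -> \bar R) (C : \bar R) :
  (forall n, 0 <= u n)%E -> (forall n, \sum_(0 <= i < n) u i <= C)%E ->
  (\sum_(i <oo) u i <= C)%E.
Proof.
move=> u0 uC; apply: lime_le; first by apply: is_cvg_nneseries => n _ _.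
by apply: nearW => n; exact: uC.
Qed.

(** Stated with the rate [1 / (m + 1) ^ 2] because both applications sample the
   time at eighth powers, where the estimates below decay at least this fast. *)
Lemma borel_cantelli_inv_square d (Om : measurableType d) (R : realType)
    (P : probability Om R) (E : nat -> set Om) (C : R) :
  0 <= C -> (forall m, measurable (E m)) ->
  (forall m, P (E m) <= (C * m.+1%:R ^- 2)%:E)%E ->
  {ae P, forall om, \forall m \near \oo, ~ E m om}.
Proof.
move=> C0 mE PE; exists (lim_sup_set E); split.
- apply: bigcap_measurable => // k _; exact: bigcup_measurable.
- apply: lim_sup_set_cvg0 => //.
  apply: (@le_lt_trans _ _ ((C * 2)%:E)); last exact: ltry.
  apply: nneseries_le_bound => [//|n].
  apply: (@le_trans _ _ (\sum_(0 <= m < n) (C * m.+1%:R ^- 2)%:E)%E).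
    by apply: lee_sum => m _; exact: PE.
  rewrite sumEFin lee_fin -mulr_sumr big_mkord ler_wpM2l//.
  by rewrite (le_trans (sum_inv_square_le _ _))// gerBl divr_ge0.
- move=> om /= nE n _; apply: contrapT => H; apply: nE.
  exists n => // m /= nm Em; apply: H; by exists m.
Qed.

Lemma eighth_root (n : nat) : (0 < n)%N ->
  exists m, (m.+1 ^ 8 <= n < m.+2 ^ 8)%N.
Proof.
move=> n0.
have ex : exists m, (m.+1 ^ 8 <= n)%N by exists 0%N; rewrite exp1n.
have bd m : (m.+1 ^ 8 <= n)%N -> (m <= n)%N.
  move=> h; apply: leq_trans h; apply: leq_trans (leqnSn m) _.
  by rewrite -[X in (X <= _)%N]expn1 leq_pexp2l.
case: (ex_maxnP ex bd) => m mn mmax; exists m; rewrite mn ltnNge/=.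
by apply/negP => /mmax; rewrite ltnn.
Qed.

(** Between consecutive eighth powers a monotone sequence changes by a factor
   tending to 1, so its averages converge once they do along eighth powers. *)
Lemma cvg_average_interpolate (R : realType) (u : nat -> R) (c : R) :
  0 <= c -> (forall n, 0 <= u n) -> (forall n m, (n <= m)%N -> u n <= u m) ->
  (\forall m \near \oo,
     `|u (m.+1 ^ 8)%N - (m.+1 ^ 8)%:R * c| < m.+1%:R ^+ 7) ->
  u n / n%:R @[n --> \oo] --> c.
Proof.
move=> c0 u0 u_nd [M1 _ HM1].
pose h (m : nat) : R := m.+1%:R^-1.
have h_cvg : h @ \oo --> (0 : R) by exact: cvg_harmonic.
have hS_cvg : (fun m => h m.+1) @ \oo --> (0 : R) by rewrite (cvg_shiftS h).
have pow_cvg : (fun m => (1 + h m) ^+ 8) @ \oo --> (1 : R).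
  rewrite -[X in _ --> X](expr1n _ 8) -[X in X ^+ 8]addr0.
  apply: (cvg_comp _ (fun x => x ^+ 8)); last exact: exprn_continuous.
  by apply: cvgD => //; exact: cvg_cst.
have up : (fun m => (1 + h m) ^+ 8 * (c + h m.+1)) @ \oo --> c.
  rewrite -[X in _ --> X](mul1r c) -[in X in _ --> X](addr0 c).
  by apply: cvgM => //; apply: cvgD => //; exact: cvg_cst.
have lo : (fun m => ((1 + h m) ^+ 8)^-1 * (c - h m)) @ \oo --> c.
  rewrite -[X in _ --> X](mul1r c) -[in X in _ --> X](subr0 c) -[1 in X in _
    --> X]invr1.
  apply: cvgM; first by apply: cvgV => //; exact: oner_neq0.
  by apply: cvgB => //; exact: cvg_cst.
apply/cvgrPdist_le => e e0.
have [M2 _ HM2] : \forall m \near \oo, (1 + h m) ^+ 8 * (c + h m.+1) <= c + e.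
  move/cvgrPdist_le : up => /(_ _ e0); apply: filterS => m.
  by rewrite ler_distl => /andP[+ _]; rewrite lerBlDr.
have [M3 _ HM3] : \forall m \near \oo, c - e <= ((1 + h m) ^+ 8)^-1 * (c - h m).
  move/cvgrPdist_le : lo => /(_ _ e0); apply: filterS => m.
  by rewrite ler_distl => /andP[_]; rewrite lerBlDr.
pose M := maxn M1 (maxn M2 M3).
exists (M.+1 ^ 8)%N => //= n Mn.
have n0 : (0 < n)%N by apply: leq_trans Mn; rewrite expn_gt0.
have [m /andP[mn nm]] := eighth_root n0.
have MM : (M <= m)%N.
  have := leq_ltn_trans Mn nm; by rewrite ltn_exp2r// ltnS.
have /andP[M1m /andP[M2m M3m]] : [&& M1 <= m, M2 <= m & M3 <= m]%N.
  by move: MM; rewrite /M !geq_max.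
have nR0 : 0 < n%:R :> R by rewrite ltr0n.
have mR0 : 0 < m.+1%:R :> R by rewrite ltr0n.
have mR1 : 0 < m.+2%:R :> R by rewrite ltr0n.
have hE : 1 + h m = m.+2%:R / m.+1%:R.
  by rewrite /h -[m.+2%:R]natr1 mulrDl mul1r divff ?gt_eqF.
have pow87 (x : R) : 0 < x -> x ^+ 8 / x = x ^+ 7.
  by move=> x0; rewrite exprSr mulfK ?gt_eqF.
have ratioE : (1 + h m) ^+ 8 = m.+2%:R ^+ 8 / m.+1%:R ^+ 8.
  by rewrite hE expr_div_n.
have a0 : 0 < m.+1%:R ^+ 8 :> R by rewrite exprn_gt0.
have b0 : 0 < m.+2%:R ^+ 8 :> R by rewrite exprn_gt0.
rewrite distrC ler_distl; apply/andP; split.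
(* [u] is compared with its value at the eighth power below [n], then with its
   value at the one above. *)
- have := HM1 m M1m; rewrite /= ltr_distl => /andP[lb _].
  have un : u (m.+1 ^ 8)%N <= u n by exact: u_nd.
  have lb' : m.+1%:R ^+ 8 * (c - h m) <= u n.
    apply: le_trans un; apply: ltW; apply: le_lt_trans lb.
    by rewrite natrX /h mulrBr lerD2l lerN2 pow87.
  apply: (le_trans (HM3 _ M3m)); rewrite ratioE invf_div mulrAC.
  rewrite (@le_trans _ _ (u n / m.+2%:R ^+ 8))// ?ler_pM2r ?invr_gt0//.
  by rewrite ler_wpM2l// lef_pV2 ?posrE// -natrX ler_nat ltnW.
- apply: le_trans (HM2 _ M2m); rewrite ratioE mulrAC.
  have := HM1 m.+1 (leqW M1m); rewrite /= ltr_distl => /andP[_ ub].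
  have ub' : u n <= m.+2%:R ^+ 8 * (c + h m.+1).
    apply: (le_trans (u_nd _ _ (ltnW nm))); apply: (le_trans (ltW ub)).
    by rewrite natrX /h mulrDr lerD2l pow87.
  apply: (@le_trans _ _ (u n / m.+1%:R ^+ 8));
    last by rewrite ler_pM2r ?invr_gt0.
  by rewrite ler_wpM2l// lef_pV2 ?posrE// -natrX ler_nat.
Qed.

Section strong_law.
Context d (Om : measurableType d) (R : realType) (P : probability Om R).
Variables (A : nat -> set Om) (c : R).
Hypothesis mA : forall i, measurable (A i).
Hypothesis PA : forall i, P (A i) = c%:E.
Hypothesis PAA : forall i j, i != j -> P (A i `&` A j) = (c ^+ 2)%:E.

(** Chebyshev's inequality along [n = (m + 1) ^ 8] with the shrinking relative
   error [1 / (m + 1)], so that a single application of the Borel-Cantelli lemma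
   covers all errors; eighth powers are the times at which the tail estimate is
   summable as well. *)
Lemma hits_strong_law :
  {ae P, forall om, hits R A n om / n%:R @[n --> \oo] --> c}.
Proof.
have c0 : 0 <= c by rewrite -lee_fin -(PA 0%N).
pose E m := [set om | m.+1%:R ^+ 7 <=
  `|hits R A (m.+1 ^ 8)%N om - (m.+1 ^ 8)%:R * c|].
have mE m : measurable (E m).
  rewrite -[E m]setTI; apply: measurable_fun_le => //.
  apply: measurableT_comp => //; apply: measurable_funB => //.
  exact: measurable_hits.
have PE m : (P (E m) <= (c * m.+1%:R ^- 2)%:E)%E.
  have m0 : 0 < m.+1%:R :> R by rewrite ltr0n.
  apply: (le_trans (hits_deviation mA PA PAA _ _)); first by rewrite exprn_gt0.
  rewrite lee_fin natrX (mulrC _ c) -mulrA ler_wpM2l// -exprM.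
  rewrite -[_ ^+ (7 * 2)]/(_ ^+ (8 + 6)) exprD invfM mulrA divff ?mul1r;
    last first.
    by rewrite expf_neq0// gt_eqF.
  rewrite lef_pV2 ?posrE ?exprn_gt0//; apply: ler_weXn2l => //.
  by rewrite ler1n.
apply: filterS (borel_cantelli_inv_square c0 mE PE) => om.
move=> Hom; apply: cvg_average_interpolate => //.
- by move=> n; exact: hits_ge0.
- by move=> n m; exact: hits_mono.
- by apply: filterS Hom => m /negP; rewrite -ltNge.
Qed.

End strong_law.

(** * Infinite strings, lexicographic order and ranks *)

Definition pref b (k : nat) (v : istr b) : k.-tuple 'I_b := [tuple v i | i < k].

Definition ext b (r : 'I_b) k (w : k.-tuple 'I_b) : istr b := nth r w.

Section strings.
Context (b : nat).
Implicit Types (v w u : istr b).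

Lemma pref_agree k v w : pref k v = pref k w <-> agree k v w.
Proof.
split=> [/(congr1 (fun t : k.-tuple 'I_b => tnth t)) E l lk|H].
  by have := congr1 (@^~ (Ordinal lk)) E; rewrite !tnth_mktuple.
by apply: eq_from_tnth => i; rewrite !tnth_mktuple; exact: H.
Qed.

Lemma pref_val k v : pref k v = mkseq v k :> seq 'I_b.
Proof. by rewrite /= /mkseq -val_enum_ord -map_comp. Qed.

Lemma pref_ext (r : 'I_b) k (w : k.-tuple 'I_b) : pref k (ext r w) = w.
Proof.
by apply: eq_from_tnth => i; rewrite tnth_mktuple /ext (tnth_nth r).
Qed.

Lemma agree_sym k v w : agree k v w -> agree k w v.
Proof. by move=> H l lk; rewrite H. Qed.

Lemma agree_trans k u v w : agree k u v -> agree k v w -> agree k u w.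
Proof. by move=> H1 H2 l lk; rewrite H1// H2. Qed.

Lemma agreeS k v w : agree k.+1 v w <-> agree k v w /\ v k = w k.
Proof.
split=> [H|[H vk] l]; first by split=> [l lk|]; apply: H => //; exact: ltnW.
by rewrite ltnS leq_eqVlt => /orP[/eqP ->//|]; exact: H.
Qed.

Lemma agree_le k k' v w : (k <= k')%N -> agree k' v w -> agree k v w.
Proof. by move=> kk H l lk; apply: H; exact: leq_trans kk. Qed.

Lemma lcp_Some v w i : lcp v w = Some i <-> agree i v w /\ v i != w i.
Proof.
split=> [E|[ag ne]].
  have /lcp_spec ag : len_ge i (lcp v w) by rewrite E /=.
  split=> //; apply/eqP => vi.
  have /lcp_spec : agree i.+1 v w by apply/agreeS.
  by rewrite E /= ltnn.
have /lcp_spec : agree i v w by [].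
have : ~ agree i.+1 v w by move/agreeS => [_ /eqP]; exact/negP.
rewrite -lcp_spec; case: (lcp v w) => [j|]//= /negP; rewrite -leqNgt => ji ij.
by congr Some; apply/eqP; rewrite eqn_leq ji.
Qed.

Lemma lex_ltP v w : lex_lt v w <-> exists2 i, agree i v w & (v i < w i)%N.
Proof.
split=> [[i /lcp_Some[ag _] lt]|[i ag lt]]; first by exists i.
by exists i => //; apply/lcp_Some; split=> //; apply/eqP => E;
  rewrite E ltnn in lt.
Qed.

Lemma first_diff v w : v <> w -> exists2 i, agree i v w & v i != w i.
Proof.
case E : (lcp v w) => [i|] vw; first by case/lcp_Some : E; exists i.
by move: E; rewrite /lcp; case: asboolP.
Qed.

Lemma lex_lt_trans u v w : lex_lt u v -> lex_lt v w -> lex_lt u w.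
Proof.
move=> /lex_ltP[i uv ui] /lex_ltP[j vw vj]; apply/lex_ltP.
have [ij|ji|ij] := ltngtP i j.
- exists i; last by rewrite -(vw i ij).
  by apply: agree_trans uv _; exact: agree_le (ltnW ij) vw.
- exists j; last by rewrite (uv j ji).
  by apply: agree_trans _ vw; exact: agree_le (ltnW ji) uv.
- subst j; exists i; last exact: ltn_trans vj.
  exact: agree_trans vw.
Qed.

Lemma lex_ltxx v : ~ lex_lt v v.
Proof. by move=> /lex_ltP[i _]; rewrite ltnn. Qed.

Lemma lex_trichotomy v w : [\/ lex_lt v w, v = w | lex_lt w v].
Proof.
have [->|vw] := pselect (v = w); first by constructor 2.
have [i ag ne] := first_diff vw.
move: ne; rewrite -val_eqE neq_ltn => /orP[lt|lt].
- by constructor 1; apply/lex_ltP; exists i.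
- by constructor 3; apply/lex_ltP; exists i => //; exact: agree_sym.
Qed.

Lemma lex_le_trans u v w : lex_le u v -> lex_le v w -> lex_le u w.
Proof.
move=> [uv|->//] [vw|<-]; [left|by left].
exact: lex_lt_trans vw.
Qed.

Lemma lex_le_lt_trans u v w : lex_le u v -> lex_lt v w -> lex_lt u w.
Proof. by move=> [uv|->//] vw; exact: lex_lt_trans vw. Qed.

Lemma lex_leNgt v w : lex_le v w <-> ~ lex_lt w v.
Proof.
split=> [vw wv|nwv]; first exact: lex_ltxx (lex_le_lt_trans vw wv).
by have [vw|vw|//] := lex_trichotomy v w; [left|right].
Qed.

Lemma lex_le_anti v w : lex_le v w -> lex_le w v -> v = w.
Proof. by move=> [vw|//] /lex_leNgt; contradiction. Qed.

Lemma lex_le_total v w : lex_le v w \/ lex_le w v.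
Proof.
by have [vw|<-|vw] := lex_trichotomy v w; [left; left|left; right|right; left].
Qed.

End strings.

Section order_statistics.
Context (Om : Type) (b : nat) (S : nat -> Om -> istr b).

(** A set closed under passing to smaller strings contains exactly an initial
   segment of the sorted sample. *)
Lemma order_stat_down (D : set (istr b)) n l om :
  (forall v w, lex_le v w -> D w -> D v) -> (1 <= l <= n)%N ->
  D (order_stat S n l om) <-> (l <= \sum_(i < n) (S i om \in D))%N.
Proof.
move=> down /andP[l1 ln].
set s := [seq S i om | i <- iota 0 n].
pose t := sort (@lex_leb b) s.
have szt : size t = n by rewrite size_sort size_map size_iota.
have sumE : (\sum_(i < n) (S i om \in D))%N = count (mem D) t.
  rewrite (permP (permEl (perm_sort _ _))) /s count_map -sum1_count
    [RHS]big_mkcond /=.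
  rewrite -(big_mkord xpredT (fun i => (S i om \in D) : nat)) /index_iota subn0.
  by apply: eq_bigr => i _; case: (_ \in _).
have lebP v w : reflect (lex_le v w) (lex_leb v w) by exact: asboolP.
have tot : total (@lex_leb b).
  by move=> v w; apply/orP; case: (lex_le_total v w) => /lebP; [left|right].
have tr : transitive (@lex_leb b).
  by move=> v u w /lebP uv /lebP vw; apply/lebP; exact: lex_le_trans vw.
have sor : sorted (@lex_leb b) t by exact: sort_sorted.
have mono i j : (i <= j < n)%N -> nth (S 0%N om) t j \in D ->
  nth (S 0%N om) t i \in D.
  move=> /andP[ij jn] /set_mem Dj; apply/mem_set; apply: down Dj; apply/lebP.
  apply: sorted_leq_nth => //; first by move=> v; apply/lebP; right.
  - by rewrite inE szt (leq_ltn_trans ij).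
  - by rewrite inE szt.
rewrite sumE /order_stat -/s -/t.
have cntE : count (mem D) t = (\sum_(0 <= i < n) (nth (S 0%N om) t i \in D))%N.
  rewrite -sum1_count -szt (big_nth (S 0%N om)) [LHS]big_mkcond /=.
  by apply: eq_bigr => i _; case: (_ \in _).
rewrite cntE (@big_cat_nat _ _ _ l)//=.
split=> [Dl|].
  rewrite (leq_trans _ (leq_addr _ _))// (eq_big_nat _ _ (F2 := fun=> 1%N)).
    by rewrite sum_nat_const_nat subn0 muln1.
  move=> i /andP[_ il]; rewrite (mono i l.-1) ?mem_set//.
  by rewrite -ltnS prednK// il.
move=> ls; apply: contrapT => nD; move: ls; apply/negP; rewrite -ltnNge.
rewrite [X in (_ + X)%N]big1_seq ?addn0; last first.
  move=> i /andP[_]; rewrite mem_index_iota => /andP[li iN].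
  apply/eqP; rewrite eqb0; apply/negP => Di; apply: nD; apply: set_mem.
  by apply: mono Di; rewrite iN (leq_trans (leq_pred _)).
rewrite -[in X in (X < _)%N](prednK l1) big_nat_recr//= memNset//= addn0.
rewrite -[X in (_ < X)%N](prednK l1) ltnS.
apply: (@leq_trans (\sum_(0 <= i < l.-1) 1)%N); last first.
  by rewrite sum_nat_const_nat subn0 muln1.
by apply: leq_sum => i _; case: (_ \in _).
Qed.

End order_statistics.

(** * Weights of words and the law of a Markov chain *)

Section word_weights.
Context (R : realType) (b : nat) (mu : 'I_b -> R) (p : 'I_b -> 'I_b -> R).
Hypothesis hpar : markov_parameters mu p.

Lemma trans_weight_rcons r (w : seq 'I_b) s :
  trans_weight p r (rcons w s) = trans_weight p r w * p (last r w) s.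
Proof. by elim: w r => [|x w IH] r /=; rewrite ?mulr1 ?mul1r// IH mulrA. Qed.

Lemma word_weight_mkseqS (v : istr b) k :
  word_weight mu p (mkseq v k.+2) =
  word_weight mu p (mkseq v k.+1) * p (v k) (v k.+1).
Proof.
rewrite mkseqS /mkseq /= trans_weight_rcons mulrA; congr (_ * p _ _).
have H m : last (v m) [seq v i | i <- iota m.+1 k] = v (m + k)%N.
  by elim: k m => [|k IH] m; rewrite ?addn0//= IH addSnnS.
exact: H 0%N.
Qed.

Lemma word_weight_gt0 (w : seq 'I_b) : 0 < word_weight mu p w.
Proof.
case: hpar => mu0 _ p0 _; case: w => [//|r w] /=.
apply: mulr_gt0; first by case/andP : (mu0 r).
elim: w r => [//|s w IH] r /=; apply: mulr_gt0 => //.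
by case/andP : (p0 r s).
Qed.

(** Every letter after the first contributes a factor at most the largest
   transition probability, which is less than 1. The rate is written as a
   sixteenth power so that the interpolation of [crowded_le] stays within
   integer powers of [r]. *)
Lemma word_weight_geometric : exists r C : R,
  [/\ 0 < r < 1, 0 < C &
    forall w : seq 'I_b, word_weight mu p w <= C * (r ^+ 16) ^+ size w].
Proof.
case: hpar => mu0 _ p0 _.
pose q := \big[Order.max/(2^-1 : R)]_(ij : 'I_b * 'I_b) p ij.1 ij.2.
have pq i j : p i j <= q.
  by rewrite /q (bigD1 (i, j))//= le_max lexx.
have q0 : 0 < q.
  rewrite /q; elim/big_ind : _ => [|x y hx hy|[i j] _ /=].
  - by rewrite invr_gt0.
  - by rewrite lt_max hx.
  - by case/andP : (p0 i j).
have q1 : q < 1.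
  rewrite /q; elim/big_ind : _ => [|x y hx hy|[i j] _ /=].
  - by rewrite invf_lt1// ltr1n.
  - by rewrite gt_max hx.
  - by case/andP : (p0 i j).
(* Bernoulli's inequality replaces the extraction of a sixteenth root. *)
have qr : exists2 r : R, 0 < r < 1 & q <= r ^+ 16.
  exists (1 - (1 - q) / 16%:R); first by apply/andP; split; lra.
  have bern (x : R) n : 0 <= x <= 1 -> 1 - n%:R * x <= (1 - x) ^+ n.
    move=> /andP[x0 x1]; elim: n => [|n IH]; first by rewrite mul0r subr0 expr0.
    rewrite exprS; apply: (@le_trans _ _ ((1 - x) * (1 - n%:R * x))).
      rewrite -subr_ge0.
      have -> : (1 - x) * (1 - n%:R * x) - (1 - n.+1%:R * x) = n%:R * x ^+ 2.
        by rewrite -natr1; ring.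
      by rewrite mulr_ge0// sqr_ge0.
    by rewrite ler_wpM2l// subr_ge0.
  apply: le_trans (bern _ _ _); last by apply/andP; split; lra.
  by rewrite le_eqVlt; apply/orP; left; apply/eqP; field.
have [r r01 rq] := qr.
exists r, q^-1; split => //; first by rewrite invr_gt0.
have tq s (w : seq 'I_b) : trans_weight p s w <= q ^+ size w.
  elim: w s => [//|x w IH] s /=; rewrite exprS.
  have := word_weight_gt0 [:: s & w]; move=> /= _.
  apply: ler_pM => //; first by case/andP : (p0 s x) => /ltW.
  elim: w x {IH} => [//|y w IH'] x /=; apply: mulr_ge0 => //.
  by case/andP : (p0 x y) => /ltW.
move=> w; apply: (@le_trans _ _ (q^-1 * q ^+ size w)); last first.
  rewrite ler_pM2l ?invr_gt0//; apply: lerXn2r; rewrite ?nnegrE ?(ltW q0)//.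
  by rewrite exprn_ge0// ltW//; case/andP : r01.
case: w => [|s w] /=; first by rewrite mulr1 invf_ge1// ltW.
rewrite exprS mulKf ?gt_eqF// -[leRHS]mul1r; apply: ler_pM => //.
- by case/andP : (mu0 s) => /ltW.
- have := word_weight_gt0 [:: s & w]; rewrite /= pmulr_rgt0 => [/ltW//|].
  by case/andP : (mu0 s).
- by case/andP : (mu0 s) => _ /ltW.
Qed.

End word_weights.

Section chain_law.
Context d (Om : measurableType d) (R : realType) (P : probability Om R).
Context (b : nat) (mu : 'I_b -> R) (p : 'I_b -> 'I_b -> R).
Variable X : Om -> istr b.
Hypothesis hX : markov_chain P mu p X.

Lemma cylinderE k (w : k.-tuple 'I_b) :
  [set om | pref k (X om) = w] =
  \bigcap_(i in [set: 'I_k]) [set om | X om i = tnth w i].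
Proof.
apply/seteqP; split=> [om /= <- i _ /=|om H]; first by rewrite tnth_mktuple.
by apply: eq_from_tnth => i; rewrite tnth_mktuple; exact: H.
Qed.

Lemma measurable_cylinder k (w : k.-tuple 'I_b) :
  measurable [set om | pref k (X om) = w].
Proof.
rewrite cylinderE; apply: fin_bigcap_measurable => // i _.
by case: hX => mX _ _; exact: mX.
Qed.

Lemma sigma_of_string_cylinder k (w : k.-tuple 'I_b) :
  sigma_of_string X [set om | pref k (X om) = w].
Proof.
pose G := [set A | exists k r, A = [set om | X om k = r]].
rewrite cylinderE.
have := @fin_bigcap_measurable _ (g_sigma_algebraType G).
apply=> // i _; apply: sub_gen_smallest; by exists i, (tnth w i).
Qed.

(** The one-step Markov property conditions on a whole past, so the law of a
   prefix follows by adding one letter at a time. *)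
Lemma cylinder_law k (w : k.-tuple 'I_b) :
  P [set om | pref k (X om) = w] = (word_weight mu p w)%:E.
Proof.
case: hX => mX X0 Xn.
have agE n (v : istr b) : [set om | agree n.+1 (X om) v] =
    [set om | agree n (X om) v /\ X om n = v n].
  by apply/seteqP; split=> om /=; rewrite agreeS.
have law n (v : istr b) :
    P [set om | agree n.+1 (X om) v] = (word_weight mu p (mkseq v n.+1))%:E.
  elim: n => [|n IH].
    rewrite agE /= mulr1 -X0; congr (P _).
    by apply/seteqP; split=> om /= => [[]|].
  by rewrite agE Xn IH -EFinM word_weight_mkseqS.
case: k w => [|k] w.
  rewrite tuple0 (_ : [set _ | _] = setT) ?probability_setT//.
  by apply/seteqP; split=> // om _; apply: eq_from_tnth => -[].
have wE := pref_ext (thead w) w.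
rewrite -{2}wE pref_val -law; congr (P _).
by apply/seteqP; split=> om /=; rewrite -pref_agree wE.
Qed.

Section cylinder_unions.
Context (k : nat) (D : pred (k.-tuple 'I_b)).

Let unionE : [set om | D (pref k (X om))] =
  \bigcup_(w in [set w | D w]) [set om | pref k (X om) = w].
Proof.
apply/seteqP; split=> [om Dom|om [w /= Dw E]]; last by rewrite E.
by exists (pref k (X om)).
Qed.

Lemma measurable_pref : measurable [set om | D (pref k (X om))].
Proof.
rewrite unionE; apply: fin_bigcup_measurable => // w _.
exact: measurable_cylinder.
Qed.

Lemma pref_law :
  P [set om | D (pref k (X om))] = (\sum_(w | D w) word_weight mu p w)%:E.
Proof.
rewrite unionE [LHS]measure_fin_bigcup//.
- rewrite -sumEFin (_ : [set w | D w] = [set` enum D]); last first.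
    by apply/seteqP; split=> w /=; rewrite mem_enum.
  rewrite -fsbig_seq ?enum_uniq// big_enum/=.
  by apply: eq_bigr => w _; exact: cylinder_law.
- exact: finite_finset.
- by move=> w1 w2 _ _ [om [/= <- <-]].
- by move=> w _; exact: measurable_cylinder.
Qed.

End cylinder_unions.

Lemma sum_word_weight k : \sum_(w : k.-tuple 'I_b) word_weight mu p w = 1.
Proof.
apply/EFin_inj; rewrite -(pref_law (k := k) xpredT).
by rewrite (_ : [set _ | _] = setT) ?probability_setT//; apply/seteqP; split.
Qed.

End chain_law.

(** * A geometric bound for all prefix counts at once *)

Lemma union_bound_fintype d (Om : measurableType d) (R : realType)
    (P : probability Om R) (T : finType) (F : T -> set Om) :
  (forall w, measurable (F w)) ->
  (P (\bigcup_(w in [set: T]) F w) <= \sum_w P (F w))%E.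
Proof.
move=> mF.
have -> : [set: T] = [set` enum T] :> set T.
  by apply/seteqP; split=> w //=; rewrite mem_enum.
have mU : measurable (\bigcup_(w in [set` enum T]) F w).
  exact: fin_bigcup_measurable.
apply: (le_trans (@content_sub_fsum _ _ _ P _ [set` enum T] _ F _ _ mU _)) =>
  //.
by rewrite -fsbig_seq ?enum_uniq// big_enum.
Qed.

Section cylinders.
Context (R : realType) (Om : Type) (b : nat) (S : nat -> Om -> istr b).

Definition cyl k (w : k.-tuple 'I_b) (i : nat) : set Om :=
  [set om | pref k (S i om) = w].

Lemma LambdaE n k v om : (Lambda S n k v om)%:R = hits R (cyl (pref k v)) n om.
Proof.
rewrite hits_nat /Lambda -sum1_card big_mkcond /=; congr (_%:R).
apply: eq_bigr => i _.
have -> : (i \in in_set [set i : 'I_n | len_ge k (lcp v (S i om))]) =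
    (om \in cyl (pref k v) i).
  apply/asboolP/idP => [/lcp_spec/pref_agree E|]; first by apply/mem_set;
    rewrite /cyl /= E.
  by move/set_mem => /= H; apply/lcp_spec/pref_agree.
by case: (_ \in _).
Qed.

End cylinders.

Section sample.
Context d (Om : measurableType d) (R : realType) (P : probability Om R).
Context (b : nat) (mu : 'I_b -> R) (p : 'I_b -> 'I_b -> R).
Hypothesis hpar : markov_parameters mu p.
Variable S : nat -> Om -> istr b.
Hypothesis hchain : forall i, markov_chain P mu p (S i).
Hypothesis hindep : independent_strings P S.

Notation wt := (word_weight mu p).

Lemma measurable_cyl k (w : k.-tuple 'I_b) i : measurable (cyl S w i).
Proof. exact: (measurable_cylinder (hchain i)). Qed.

Lemma cyl_law k (w : k.-tuple 'I_b) i : P (cyl S w i) = (wt w)%:E.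
Proof. exact: cylinder_law. Qed.

Lemma cyl_indep k (w : k.-tuple 'I_b) i j : i != j ->
  P (cyl S w i `&` cyl S w j) = (wt w ^+ 2)%:E.
Proof.
move=> ij; have := hindep (J := [:: i; j]) (A := cyl S w).
rewrite /= inE ij => /(_ isT) H.
rewrite !big_cons big_nil mule1 !cyl_law -EFinM -expr2 in H.
rewrite -H => [|l _]; last exact: sigma_of_string_cylinder.
congr (P _); apply/seteqP; split=> [om [oi oj] l /=|om /= o].
  by rewrite !inE => /orP[]/eqP ->.
by split; apply: o; rewrite /= !inE eqxx ?orbT.
Qed.

Lemma ae_word_averages :
  {ae P, forall om, forall k (w : k.-tuple 'I_b),
    hits R (cyl S w) n om / n%:R @[n --> \oo] --> wt w}.
Proof.
apply/ae_foralln => k; apply: filter_forall => w.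
apply: hits_strong_law; first exact: measurable_cyl.
- exact: cyl_law.
- by move=> i j; exact: cyl_indep.
Qed.

Section tail.
Variables (r C : R).
Hypothesis r01 : 0 < r < 1.
Hypothesis C0 : 0 < C.
Hypothesis wtC : forall w : seq 'I_b, wt w <= C * (r ^+ 16) ^+ size w.

Let r0 : 0 < r. Proof. by case/andP : r01. Qed.
Let r1 : r < 1. Proof. by case/andP : r01. Qed.

Lemma sum_wt_sqr_le k :
  \sum_(w : k.-tuple 'I_b) wt w ^+ 2 <= C * (r ^+ 16) ^+ k.
Proof.
rewrite -[leRHS]mulr1 -(sum_word_weight (hchain 0%N) k) mulr_sumr.
apply: ler_sum => w _; rewrite expr2 ler_pM2r ?word_weight_gt0//.
by rewrite -[in leRHS](size_tuple w).
Qed.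

Let crowded n k (w : k.-tuple 'I_b) : set Om :=
  [set om | 2 <= hits R (cyl S w) n om] `&`
  [set om | n%:R * (r ^+ 2) ^+ k <= `|hits R (cyl S w) n om - n%:R * wt w|].

Let measurable_crowded n k (w : k.-tuple 'I_b) : measurable (crowded n w).
Proof.
have mc := measurable_cyl w.
apply: measurableI; first exact: measurable_hits_ge.
rewrite -[X in measurable X]setTI; apply: measurable_fun_le => //.
apply: measurableT_comp => //; apply: measurable_funB => //.
exact: measurable_hits.
Qed.

(** Chebyshev's inequality bounds the probability by [x = r ^ (-4k) / n], and
   the chance of two hits by [y = C * n ^ 2 * r ^ (16k)]; hence its fourth power
   is at most [x ^ 3 * y = C * r ^ (4k) / n], that is, with [n = (m + 1) ^ 8],
   the fourth power of [r ^ k / (m + 1) ^ 2] times [C]. *)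
Let crowded_le (m k : nat) :
  (P (\bigcup_(w in [set: k.-tuple 'I_b]) crowded (m.+1 ^ 8) w)
   <= ((1 + C) * m.+1%:R ^- 2 * r ^+ k)%:E)%E.
Proof.
set U := (X in P X).
have mU : measurable U by apply: fin_bigcup_measurable => // w _.
set x : R := m.+1%:R.
have x0 : 0 < x by rewrite ltr0n.
have nx : (m.+1 ^ 8)%:R = x ^+ 8 :> R by rewrite natrX.
have PU : P U = (fine (P U))%:E by rewrite fineK// fin_num_measure.
have z0 : 0 <= fine (P U) by rewrite fine_ge0.
have le1 : fine (P U) <= (x ^+ 8 * (r ^+ 2) ^+ k ^+ 2)^-1.
  rewrite -lee_fin -PU; apply: (le_trans (union_bound_fintype _ _)) => //.
  apply: (@le_trans _ _ (\sum_(w : k.-tuple 'I_b)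
      (wt w * (x ^+ 8 * (r ^+ 2) ^+ k ^+ 2)^-1)%:E)%E).
    apply: lee_sum => w _.
    have mc := measurable_cyl w.
    apply: (@le_trans _ _ (P [set om | (m.+1 ^ 8)%:R * (r ^+ 2) ^+ k <=
        `|hits R (cyl S w) (m.+1 ^ 8) om - (m.+1 ^ 8)%:R * wt w|])).
      apply: le_measure; rewrite ?inE//; last by move=> om [].
      rewrite -[X in measurable X]setTI; apply: measurable_fun_le => //.
      apply: measurableT_comp => //; apply: measurable_funB => //.
      exact: measurable_hits.
    apply: (le_trans (hits_deviation mc (cyl_law w) (@cyl_indep _ w) _ _)).
      by rewrite mulr_gt0 ?exprn_gt0// ltr0n expn_gt0.
    rewrite lee_fin nx (mulrC _ (wt w)) -mulrA ler_wpM2l//.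
      by rewrite ltW// word_weight_gt0.
    rewrite exprMn expr2 -mulrA invfM mulrA divff ?mul1r// expf_neq0// gt_eqF//.
  by rewrite sumEFin -mulr_suml (sum_word_weight (hchain 0%N)) mul1r.
have le2 : fine (P U) <= x ^+ 16 * (C * (r ^+ 16) ^+ k).
  rewrite -lee_fin -PU; apply: (le_trans (union_bound_fintype _ _)) => //.
  apply: (@le_trans _ _ (\sum_(w : k.-tuple 'I_b) (x ^+ 16 * wt w ^+ 2)%:E)%E).
    apply: lee_sum => w _.
    have mc := measurable_cyl w.
    apply: (@le_trans _ _ (P [set om | 2 <= hits R (cyl S w) (m.+1 ^ 8) om])).
      apply: le_measure; rewrite ?inE//; last by move=> om [].
      exact: measurable_hits_ge.
    apply: (le_trans (two_hits mc (cyl_law w) (@cyl_indep _ w) _)).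
    by rewrite lee_fin nx -exprM.
  by rewrite sumEFin -mulr_sumr lee_fin ler_wpM2l ?exprn_ge0 ?(ltW x0)//
    sum_wt_sqr_le.
rewrite PU lee_fin -(@ler_pXn2r _ 4)// ?nnegrE//; last first.
  by rewrite !mulr_ge0// ?invr_ge0 ?exprn_ge0 ?addr_ge0// ltW.
apply: (@le_trans _ _ ((x ^+ 8 * (r ^+ 2) ^+ k ^+ 2)^-1 ^+ 3 *
   (x ^+ 16 * (C * (r ^+ 16) ^+ k)))).
  rewrite exprSr; apply: ler_pM => //; first exact: exprn_ge0.
  by apply: lerXn2r; rewrite ?nnegrE// invr_ge0 mulr_ge0// !exprn_ge0// ltW.
set y := r ^+ k.
have y0 : 0 < y by rewrite exprn_gt0.
have -> : (r ^+ 2) ^+ k = y ^+ 2 by rewrite /y -!exprM mulnC.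
have -> : (r ^+ 16) ^+ k = y ^+ 16 by rewrite /y -!exprM mulnC.
have -> : (x ^+ 8 * y ^+ 2 ^+ 2)^-1 ^+ 3 * (x ^+ 16 * (C * y ^+ 16)) =
  C * (x ^- 2 * y) ^+ 4.
  by field; rewrite !gt_eqF.
have xy0 : 0 <= (x ^- 2 * y) ^+ 4.
  by rewrite exprn_ge0// mulr_ge0 ?invr_ge0 ?exprn_ge0// ltW.
rewrite -mulrA [leRHS]exprMn ler_wpM2r//.
apply: (@le_trans _ _ (1 + C)); first by rewrite lerDr.
by rewrite ler_eXnr// lerDl ltW.
Qed.

(** The time is random but common to all words of all lengths. Single hits have
   to be excluded: a word of any length has one as soon as it is a prefix of a
   sample string. The constant 256 is [2 ^ 8], a bound for the ratio of
   consecutive eighth powers. *)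
Lemma ae_geometric_tail : exists K : R, 0 < K /\
  {ae P, forall om, \forall n \near \oo, forall k (w : k.-tuple 'I_b),
     2 <= hits R (cyl S w) n om ->
       hits R (cyl S w) n om <= K * n%:R * (r ^+ 2) ^+ k}.
Proof.
exists (256%:R * (1 + C)); split; first by rewrite mulr_gt0// addr_gt0.
pose E m := \bigcup_k \bigcup_(w in [set: k.-tuple 'I_b]) crowded (m.+1 ^ 8) w.
have mU m k : measurable (\bigcup_(w in [set: k.-tuple 'I_b]) crowded (m.+1 ^
  8) w).
  by apply: fin_bigcup_measurable => // w _.
have mE m : measurable (E m) by exact: bigcup_measurable.
have PE m : (P (E m) <= ((1 + C) / (1 - r) * m.+1%:R ^- 2)%:E)%E.
  apply: le_trans (_ : _ <= \sum_(k <oo) P (\bigcup_(w in [set: k.-tuple 'I_b])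
    crowded (m.+1 ^ 8) w))%E _.
    exact: (measure_sigma_subadditive P (mU m) (mE m)).
  apply: nneseries_le_bound => // n.
  apply: (@le_trans _ _ (\sum_(0 <= k < n) ((1 + C) * m.+1%:R ^- 2 * r ^+
    k)%:E)%E).
    by apply: lee_sum => k _; exact: crowded_le.
  rewrite sumEFin lee_fin big_mkord mulrAC; apply: sum_geometric_le => //.
  by rewrite mulr_ge0// ?addr_ge0// ?(ltW C0)// invr_ge0 exprn_ge0.
have B0 : 0 <= (1 + C) / (1 - r).
  by rewrite divr_ge0 ?subr_ge0 ?(ltW r1)// addr_ge0// ltW.
apply: filterS (borel_cantelli_inv_square B0 mE PE) => om [M _ HM].
exists (M.+1 ^ 8)%N => //= n Mn k w h2.
have [m /andP[mn nm]] : exists m, (m.+1 ^ 8 <= n < m.+2 ^ 8)%N.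
  by apply: eighth_root; apply: leq_trans Mn; rewrite expn_gt0.
have Mm : (M <= m)%N by have := leq_ltn_trans Mn nm; rewrite ltn_exp2r// ltnS.
have hm : hits R (cyl S w) n om <= hits R (cyl S w) (m.+2 ^ 8) om.
  by apply: hits_mono; exact: ltnW.
have nE : ~ E m.+1 om by apply: HM; exact: leqW.
have /negP : ~ (m.+2 ^ 8)%:R * (r ^+ 2) ^+ k <=
   `|hits R (cyl S w) (m.+2 ^ 8) om - (m.+2 ^ 8)%:R * wt w|.
  by move=> H; apply: nE; exists k => //; exists w => //; split=> //=;
    exact: le_trans hm.
rewrite -ltNge ltr_distl => /andP[_ ub].
apply: (le_trans hm); apply: (le_trans (ltW ub)).
have wtr : wt w <= C * (r ^+ 2) ^+ k.
  apply: (le_trans (wtC w)); rewrite size_tuple ler_pM2l//.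
  rewrite -!exprM; apply: ler_wiXn2l; rewrite ?(ltW r0) ?(ltW r1)//.
  by rewrite leq_mul2r orbT.
rewrite -mulrDr; apply: (@le_trans _ _ ((m.+2 ^ 8)%:R * ((1 + C) * (r ^+ 2) ^+
  k))).
  by rewrite ler_wpM2l// mulrDl mul1r addrC lerD2l.
rewrite [leRHS](_ : _ = (256 * n)%:R * ((1 + C) * (r ^+ 2) ^+ k)); last first.
  by rewrite natrM; ring.
rewrite ler_wpM2r//; first by rewrite mulr_ge0 ?addr_ge0 ?exprn_ge0// ltW.
rewrite ler_nat; apply: (@leq_trans (2 ^ 8 * m.+1 ^ 8));
  last by rewrite leq_mul2l.
by rewrite -expnMn leq_exp2r// mul2n -addnn addSnnS leq_addl.
Qed.

End tail.

End sample.

(** * Almost sure limits of the series *)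

Lemma cvg_EFin_real (R : realType) (u : nat -> R) (l : R) :
  u n @[n --> \oo] --> l -> (u n)%:E @[n --> \oo] --> l%:E.
Proof. by move=> ul; apply/fine_cvgP; split; [exact: nearW|exact: ul]. Qed.

(** Tannery's theorem, that is, dominated convergence for the counting
   measure. *)
Lemma tannery (R : realType) (z : nat -> nat -> R) (a g : nat -> R) :
  (forall n k, 0 <= z n k) -> (forall k, 0 <= g k) ->
  (\sum_(k <oo) (g k)%:E < +oo)%E ->
  (\forall n \near \oo, forall k, z n k <= g k) ->
  (forall k, z n k @[n --> \oo] --> a k) ->
  ((\sum_(k <oo) (z n k)%:E)%E @[n --> \oo] --> (\sum_(k <oo) (a k)%:E)%E).
Proof.
move=> z0 g0 gfin zg za.
have a0 k : 0 <= a k.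
  by apply: (ler_cvg_to (cvg_cst (0 : R)) (za k)); apply: nearW.
pose z' n k := Order.min (z n k) (g k).
have z'0 n k : 0 <= z' n k by rewrite /z' le_min z0 g0.
have mnat (f : nat -> \bar R) : measurable_fun [set: nat] f by [].
have ig : (@counting nat R).-integrable setT (fun k => (g k)%:E).
  apply/integrableP; split=> //.
  under eq_integral do rewrite gee0_abs ?lee_fin//.
  by rewrite ge0_integral_count.
have cvg_z' k : (z' n k)%:E @[n --> \oo] --> (a k)%:E.
  apply: cvg_EFin_real; apply: cvg_trans (za k).
  by apply: near_eq_cvg; apply: filterS zg => n H; rewrite /z' min_l.
have [] := @dominated_convergence _ nat R counting setT measurableT
  (fun n k => (z' n k)%:E) (fun k => (a k)%:E) (fun k => (g k)%:E)
  (fun n => mnat _) (mnat _) _ ig _.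
- by apply: aeW => k _; exact: cvg_z'.
- by apply: aeW => k n _; rewrite gee0_abs ?lee_fin// /z' ge_min lexx orbT.
move=> _ _; rewrite ge0_integral_count// => H.
apply: cvg_trans H; apply: near_eq_cvg.
apply: filterS zg => n H /=; rewrite ge0_integral_count; last first.
  by move=> k; rewrite lee_fin.
by apply: eq_eseriesr => k _; rewrite /z' min_l.
Qed.

Section scaled_counts.
Context (R : realType) (Om : Type) (b : nat) (S : nat -> Om -> istr b).

Definition scaled_count n k (v : istr b) om : R :=
  (if (1 < Lambda S n k v om)%N then (Lambda S n k v om)%:R else 0) / n%:R.

Lemma scaled_count_ge0 n k v om : 0 <= scaled_count n k v om.
Proof. by rewrite divr_ge0//; case: ifP. Qed.

Lemma scaled_ZE n v om : (Z R S n v om * (n%:R^-1)%:E =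
  \sum_(k <oo) (scaled_count n k v om)%:E)%E.
Proof.
rewrite muleC /Z -nneseriesZl; last by move=> k _; rewrite lee_fin; case: ifP.
by apply: eq_eseriesr => k _; rewrite /scaled_count -EFinM mulrC.
Qed.

End scaled_counts.

Lemma prefix_massE (R : realType) b (mu : 'I_b -> R) (p : 'I_b -> 'I_b -> R)
    (v : istr b) : markov_parameters mu p ->
  prefix_mass mu p v = (\sum_(k <oo) (word_weight mu p (pref k v))%:E)%E.
Proof.
move=> hpar; rewrite /prefix_mass.
have -> : [set w | is_prefix w v] = mkseq v @` [set: nat].
  apply/seteqP; split=> [w /= E|_ [k _ <-]]; first by exists (size w).
  by rewrite /= /is_prefix size_mkseq.
rewrite esum_set_image.
- by apply: congr_lim; apply/funext => n; apply: eq_big => [k|k _];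
    rewrite ?in_setT// pref_val.
- by move=> k _; rewrite lee_fin ltW// word_weight_gt0.
- by move=> k l _ _ /(congr1 size); rewrite !size_mkseq.
Qed.

(** A pathwise statement: [V n] and [v] are arbitrary strings, which may have
   been chosen after looking at the sample. *)
Lemma scaled_Z_cvg (R : realType) (Om : Type) b (mu : 'I_b -> R)
    (p : 'I_b -> 'I_b -> R) (S : nat -> Om -> istr b) (om : Om) (K r : R)
    (V : nat -> istr b) (v : istr b) :
  markov_parameters mu p -> 0 < K -> 0 < r < 1 ->
  (forall k (w : k.-tuple 'I_b),
    hits R (cyl S w) n om / n%:R @[n --> \oo] --> word_weight mu p w) ->
  (\forall n \near \oo, forall k (w : k.-tuple 'I_b),
     2 <= hits R (cyl S w) n om ->
       hits R (cyl S w) n om <= K * n%:R * r ^+ k) ->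
  (forall k, \forall n \near \oo, agree k (V n) v) ->
  (Z R S n (V n) om * (n%:R^-1)%:E)%E @[n --> \oo] --> prefix_mass mu p v.
Proof.
move=> hpar K0 /andP[r0 r1] avg tail Vv.
rewrite prefix_massE//; under eq_fun do rewrite scaled_ZE.
have n0 : \forall n \near \oo, (0 < n)%N by exists 1%N.
apply: (tannery (g := fun k => K * r ^+ k)).
- by move=> n k; exact: scaled_count_ge0.
- by move=> k; rewrite mulr_ge0 ?exprn_ge0// ltW.
- apply: (@le_lt_trans _ _ (K / (1 - r))%:E); last exact: ltry.
  apply: nneseries_le_bound => n;
    first by rewrite lee_fin mulr_ge0 ?exprn_ge0// ltW.
  by rewrite sumEFin lee_fin big_mkord; apply: sum_geometric_le;
    rewrite ?r0 ?r1 ?ltW.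
- apply: filterS2 tail n0 => n H n0 k; rewrite /scaled_count; case: ifPn => L.
    rewrite LambdaE ler_pdivrMr ?ltr0n// mulrAC; apply: H.
    by rewrite -LambdaE ler_nat.
  by rewrite mul0r mulr_ge0 ?exprn_ge0// ltW.
- move=> k; set w := pref k v.
  have w0 : 0 < word_weight mu p w by exact: word_weight_gt0.
  (* The positive weight of the prefix makes the count at least 2 eventually. *)
  have many : \forall n \near \oo, 1 < hits R (cyl S w) n om.
    have h2 : \forall n \near \oo,
      word_weight mu p w / 2 <= hits R (cyl S w) n om / n%:R.
      by apply: cvgr_ge (avg k w) _ _; rewrite ltr_pdivrMr// ltr_pMr// ltr1n.
    have h3 : \forall n \near \oo, 2 / word_weight mu p w < n%:R.
      exact: nbhs_infty_gtr.
    near=> n.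
    have nR : 0 < n%:R :> R by rewrite ltr0n; near: n.
    have hn : word_weight mu p w / 2 * n%:R <= hits R (cyl S w) n om.
      by rewrite -ler_pdivlMr//; near: n.
    apply: lt_le_trans hn; have : 2 / word_weight mu p w < n%:R by near: n.
    by rewrite ltr_pdivrMr// mulrAC ltr_pdivlMr// mul1r mulrC.
  apply: cvg_trans (avg k w); apply: near_eq_cvg.
  apply: filterS2 many (Vv k) => n h /pref_agree E.
  rewrite /scaled_count -(ltr_nat R) LambdaE E h.
  by [].
Unshelve. all: by end_near.
Qed.

(** * From almost sure convergence to convergence of moments *)

Lemma cvge_expe (R : realType) (u : nat -> \bar R) (l : \bar R) q :
  (0 <= l)%E -> u n @[n --> \oo] --> l ->
  (u n ^+ q)%E @[n --> \oo] --> (l ^+ q)%E.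
Proof.
move=> l0 ul; elim: q => [|q IH].
  by under eq_fun do rewrite expe0; exact: cvg_cst.
rewrite expeS; under eq_fun do rewrite expeS.
apply: cvgeM => //; rewrite /mule_def.
case: q {IH} => [|q]; first by rewrite expe0; case: l l0 {ul}.
case: l l0 {ul} => [l _|_|//]; first by rewrite -EFin_expe.
have : (0 < (+oo : \bar R) ^+ q.+1)%E by exact: expe_gt0.
by case: (_ ^+ _)%E => [s||]//; rewrite lte_fin => /lt0r_neq0.
Qed.

Lemma measurable_fun_expe d (Om : measurableType d) (R : realType)
    (f : Om -> \bar R) q : measurable_fun setT f ->
  measurable_fun setT (fun om => f om ^+ q)%E.
Proof.
move=> mf; elim: q => [|q IH].
  by under eq_fun do rewrite expe0; exact: measurable_cst.
by under eq_fun do rewrite expeS; exact: emeasurable_funM.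
Qed.

Lemma lee_expe (R : realType) (x y : \bar R) q :
  (0 <= x -> x <= y -> x ^+ q <= y ^+ q)%E.
Proof.
move=> x0 xy; elim: q => [//|q IH]; rewrite !expeS; apply: lee_pmul => //.
exact: expe_ge0.
Qed.

(** Almost sure convergence and bounds on all moments: the part of [X n ^+ q]
   above the level [L] is at most [X n ^+ q.+1 / L], and the truncation at [L]
   is a case of bounded convergence. *)
Lemma moments_cvg d (Om : measurableType d) (R : realType)
    (P : probability Om R) (X : nat -> Om -> \bar R) (x : R) :
  0 <= x -> (forall n, measurable_fun setT (X n)) ->
    (forall n om, 0 <= X n om)%E ->
  {ae P, forall om, X n om @[n --> \oo] --> x%:E} ->
  (forall q, exists C : R, forall n, (\int[P]_om (X n om ^+ q) <= C%:E)%E) ->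
  forall q, (\int[P]_om (X n om ^+ q))%E @[n --> \oo] --> (x%:E ^+ q)%E.
Proof.
move=> x0 mX X0 Xx bd q.
have [C HC] := bd q.+1; have [D HD] := bd q.
have C0 : 0 <= C.
  rewrite -lee_fin; apply: le_trans (HC 0%N); apply: integral_ge0 => om _.
  exact: expe_ge0.
pose M L n om := mine (X n om) L%:E.
have M0 L n om : 0 <= L -> (0 <= M L n om)%E.
  by move=> L0; rewrite /M le_min X0 lee_fin.
have mM L n : measurable_fun setT (M L n).
  by apply: measurable_mine => //; exact: measurable_cst.
have Mcvg L : x < L -> (\int[P]_om (M L n om ^+ q))%E @[n --> \oo] --> (x%:E ^+
  q)%E.
  move=> xL; have L0 : 0 <= L by rewrite (le_trans x0)// ltW.
  have [] := @dominated_convergence _ Om R P setT measurableT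
    (fun n om => (M L n om ^+ q)%E) (fun=> (x%:E ^+ q)%E) (fun=> (L%:E ^+ q)%E)
      _ _ _ _ _.
  - by move=> n; exact: measurable_fun_expe.
  - exact: measurable_cst.
  - apply: filterS Xx => om Xom _; apply: cvge_expe; rewrite ?lee_fin//.
    have [fX /cvgr_lt /(_ _ xL) ltX] := (fine_cvgP _ _).1 Xom.
    apply: cvg_trans Xom; apply: near_eq_cvg;
      apply: filterS2 fX ltX => n fXn /=.
    by rewrite -lte_fin fineK// => h; rewrite /M min_l// ltW.
  - rewrite -EFin_expe; exact: finite_measure_integrable_cst.
  - apply: aeW => om n _; rewrite gee0_abs ?expe_ge0 ?M0//.
    by apply: lee_expe; [exact: M0|rewrite /M ge_min lexx orbT].
  move=> _ _; rewrite integral_cst//= probability_setT mule1.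
  exact.
have split_le L n : 0 < L -> (\int[P]_om (X n om ^+ q) <=
    \int[P]_om (M L n om ^+ q) + (C / L)%:E)%E.
  move=> L0.
  have tail0 om : (0 <= (L^-1)%:E * X n om ^+ q.+1)%E.
    by apply: mule_ge0; [rewrite lee_fin invr_ge0 ltW|exact: expe_ge0].
  apply: (@le_trans _ _ (\int[P]_om (M L n om ^+ q + (L^-1)%:E * X n om ^+
    q.+1))%E).
    apply: ge0_le_integral => //.
    - by move=> om _; exact: expe_ge0.
    - exact: measurable_fun_expe.
    - apply: emeasurable_funD; first exact: measurable_fun_expe.
      by apply: measurable_funeM; exact: measurable_fun_expe.
    - move=> om _; rewrite /M; have [h|h] := leP (X n om) L%:E.
        by rewrite leeDl.
      apply: (@le_trans _ _ ((L^-1)%:E * X n om ^+ q.+1)%E); last first.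
        by rewrite leeDr// expe_ge0// lee_fin ltW.
      rewrite expeS muleA -[leLHS]mul1e lee_wpmul2r ?expe_ge0//.
      by rewrite lee_pdivlMl// mule1 ltW.
  rewrite ge0_integralD//; last first.
  - by apply: measurable_funeM; exact: measurable_fun_expe.
  - exact: measurable_fun_expe.
  - by move=> om _; rewrite expe_ge0// M0// ltW.
  rewrite leeD2l// ge0_integralZl_EFin//; last first.
  - by rewrite invr_ge0 ltW.
  - exact: measurable_fun_expe.
  - by move=> om _; exact: expe_ge0.
  by rewrite mulrC EFinM lee_wpmul2l// lee_fin invr_ge0 ltW.
have lower L n : 0 <= L ->
  (\int[P]_om (M L n om ^+ q) <= \int[P]_om (X n om ^+ q))%E.
  move=> L0; apply: ge0_le_integral => //.
  - by move=> om _; rewrite expe_ge0// M0.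
  - exact: measurable_fun_expe.
  - exact: measurable_fun_expe.
  - by move=> om _; apply: lee_expe; [exact: M0|rewrite /M ge_min lexx].
have finX n : (\int[P]_om (X n om ^+ q))%E \is a fin_num.
  rewrite ge0_fin_numE; first exact: le_lt_trans (HD n) (ltry _).
  by apply: integral_ge0 => om _; exact: expe_ge0.
rewrite -EFin_expe; apply/fine_cvgP; split; first exact: nearW.
apply/cvgrPdist_le => e e0.
pose L := x + 1 + 2 * C / e.
have CL0 : 0 <= 2 * C / e by rewrite divr_ge0 ?mulr_ge0// ltW.
have xL : x < L by rewrite /L -addrA ltrDl ltr_wpDr.
have L0 : 0 < L by exact: le_lt_trans xL.
have CL : C / L <= e / 2.
  rewrite ler_pdivrMr// mulrC mulrA ler_pdivlMr// -ler_pdivrMr// /L [C *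
    2]mulrC.
  by rewrite lerDr addr_ge0.
have : \forall n \near \oo,
  (`|x ^+ q - fine (\int[P]_om (M L n om ^+ q))| <= e / 2)%R.
  have := Mcvg L xL; rewrite -EFin_expe => /fine_cvgP[_] /cvgrPdist_le; apply.
  by rewrite divr_gt0.
apply: filterS => n; rewrite !ler_distl => /andP[h1 h2].
have finM : (\int[P]_om (M L n om ^+ q))%E \is a fin_num.
  rewrite ge0_fin_numE.
    by apply: le_lt_trans (lower L n (ltW L0)) _; rewrite ltey_eq finX.
  by apply: integral_ge0 => om _; rewrite expe_ge0// M0// ltW.
have := split_le L n L0; have := lower L n (ltW L0).
rewrite -(fineK (finX n)) -(fineK finM) -EFinD !lee_fin => l1 l2 /=.
apply/andP; split; lra.
Qed.

(** * Uniform moment bounds *)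

Lemma expr_addr_le (R : realType) (A z : R) k q :
  0 <= A <= k%:R -> 0 <= z <= 1 ->
  (A + z) ^+ q <= A ^+ q + q%:R * k.+1%:R ^+ q * z.
Proof.
move=> /andP[A0 Ak] /andP[z0 z1].
have Az0 : 0 <= A + z by rewrite addr_ge0.
have Azk : A + z <= k.+1%:R by rewrite -natr1 lerD.
elim: q => [|q IH]; first by rewrite !expr0 !mul0r addr0.
have k0 : 0 <= k.+1%:R ^+ q :> R by rewrite exprn_ge0.
rewrite exprS mulrDl;
  apply: (@le_trans _ _ (A * (A ^+ q + q%:R * k.+1%:R ^+ q * z)
    + z * k.+1%:R ^+ q.+1)).
  apply: lerD; first by rewrite ler_wpM2l.
  rewrite ler_wpM2l// exprS; apply: (@le_trans _ _ (k.+1%:R ^+ q)).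
    by apply: lerXn2r; rewrite ?nnegrE.
  by rewrite ler_peMl// ler1n.
rewrite mulrDr -exprS -addrA lerD2l.
rewrite -[q.+1%:R]natr1 !mulrDl mul1r (mulrC z) lerD2r.
rewrite !mulrA ler_wpM2r// exprS mulrA ler_wpM2r// mulrC ler_wpM2l//.
by rewrite (le_trans Ak)// ler_nat.
Qed.

(** Expanding the power, a monomial is at most its factor of largest index,
   which makes the bound linear in the terms. *)
Lemma expr_sum_le (R : realType) (z : nat -> R) K q :
  (forall k, 0 <= z k <= 1) ->
  (\sum_(k < K) z k) ^+ q <= 1 + \sum_(k < K) q%:R * k.+1%:R ^+ q * z k.
Proof.
move=> z01; have z0 k : 0 <= z k by case/andP : (z01 k).
elim: K => [|K IH]; first by rewrite !big_ord0 addr0 expr0n; case: q.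
rewrite !big_ord_recr/= addrA;
  apply: (le_trans (expr_addr_le (k := K) _ _ _)) => //.
  rewrite sumr_ge0//= -[leRHS](_ : \sum_(k < K) 1 = _); last first.
    by rewrite sumr_const card_ord.
  by apply: ler_sum => k _; case/andP : (z01 k).
by rewrite lerD2r.
Qed.

(** Each factor [k + 1] is absorbed by passing from the ratio [r] to [s] with
   [r <= s ^ 2], as [(k + 1) * s ^ k] is at most the sum of the geometric series
   of ratio [s]. *)
Lemma sum_poly_geometric_le (R : realType) q : forall r : R, 0 < r < 1 ->
  exists C : R, 0 <= C /\ forall n, \sum_(k < n) k.+1%:R ^+ q * r ^+ k <= C.
Proof.
elim: q => [|q IH] r /andP[r0 r1].
  exists (1 - r)^-1; split; first by rewrite invr_ge0 subr_ge0 ltW.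
  move=> n; under eq_bigr do rewrite expr0.
  by rewrite -[leRHS]mul1r; apply: sum_geometric_le; rewrite ?r0.
pose s := (1 + r) / 2.
have s01 : 0 < s < 1 by rewrite /s; apply/andP; split; lra.
have /andP[s0 s1] := s01.
have rs : r <= s ^+ 2.
  rewrite -subr_ge0; have -> : s ^+ 2 - r = ((1 - r) / 2) ^+ 2 by rewrite /s;
    field.
  exact: sqr_ge0.
have linear k : k.+1%:R * s ^+ k <= (1 - s)^-1.
  apply: (@le_trans _ _ (\sum_(i < k.+1) 1 * s ^+ i)); last first.
    by rewrite -[leRHS]mul1r; apply: sum_geometric_le; rewrite ?s0.
  rewrite mulr_natl -[X in _ *+ X]card_ord -sumr_const; apply: ler_sum => i _.
  by rewrite mul1r; apply: ler_wiXn2l;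
    rewrite ?(ltW s0) ?(ltW s1)// -ltnS ltn_ord.
have [C [C0 HC]] := IH s s01.
exists ((1 - s)^-1 * C); split;
  first by rewrite mulr_ge0// invr_ge0 subr_ge0 ltW.
move=> n; apply: (@le_trans _ _ (\sum_(k < n) (1 - s)^-1 * (k.+1%:R ^+ q * s ^+
  k))).
  apply: ler_sum => k _;
    apply: (@le_trans _ _ (k.+1%:R ^+ q.+1 * (s ^+ 2) ^+ k)).
    by rewrite ler_wpM2l// lerXn2r ?nnegrE ?sqr_ge0// ltW.
  rewrite exprS -exprM mul2n -addnn exprD.
  have -> : k.+1%:R * k.+1%:R ^+ q * (s ^+ k * s ^+ k) =
     (k.+1%:R * s ^+ k) * (k.+1%:R ^+ q * s ^+ k) by ring.
  by rewrite ler_wpM2r// mulr_ge0// ?exprn_ge0// ltW.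
by rewrite -mulr_sumr ler_wpM2l ?HC// invr_ge0 subr_ge0 ltW.
Qed.

Section collisions.
Context (R : realType) (Om : Type) (b : nat) (S : nat -> Om -> istr b).

(** The proportion of ordered pairs of distinct sample strings that share a
   prefix of length [k]; it bounds the scaled counts of all strings at once. *)
Definition collisions n k om : R :=
  (\sum_(w : k.-tuple 'I_b) hits R (cyl S w) n om * (hits R (cyl S w) n om - 1))
    / n%:R ^+ 2.

Lemma collisions_ge0 n k om : 0 <= collisions n k om.
Proof.
rewrite divr_ge0 ?sqr_ge0// sumr_ge0// => w _; exact: hits_pairs_ge0.
Qed.

Lemma scaled_countE n k v om :
  scaled_count R S n k v om =
  if 2 <= hits R (cyl S (pref k v)) n om then hits R (cyl S (pref k v)) n om /
    n%:R else 0.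
Proof.
rewrite /scaled_count -LambdaE -(ler_nat R).
by case: ifP => //; rewrite mul0r.
Qed.

Lemma scaled_count_le1 n k v om : scaled_count R S n k v om <= 1.
Proof.
rewrite scaled_countE; case: ifP => // _.
case: n => [|n]; first by rewrite invr0 mulr0.
by rewrite ler_pdivrMr ?ltr0n// mul1r hits_le.
Qed.

Lemma scaled_count_sqr_le n k v om :
  scaled_count R S n k v om ^+ 2 <= 2 * collisions n k om.
Proof.
have c0 := collisions_ge0 n k om.
rewrite scaled_countE; case: ifPn => [h2|_]; last by rewrite expr0n mulr_ge0.
rewrite expr_div_n /collisions mulrA ler_wpM2r ?invr_ge0 ?sqr_ge0//.
rewrite (bigD1 (pref k v))//= mulrDr; set h := hits _ _ _ _ in h2 *.
apply: (@le_trans _ _ (2 * (h * (h - 1)))); first by nra.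
rewrite lerDl mulr_ge0// sumr_ge0// => w _; exact: hits_pairs_ge0.
Qed.

(** The first moment from the second: either the count is below [s ^+ k], or its
   square exceeds [s ^+ k] times the count. *)
Lemma scaled_count_le (s : R) n k v om : 0 < s ->
  scaled_count R S n k v om <= s ^+ k + 2 * collisions n k om / s ^+ k.
Proof.
move=> s0; have sk0 : 0 < s ^+ k by rewrite exprn_gt0.
have c0 : 0 <= 2 * collisions n k om by rewrite mulr_ge0// collisions_ge0.
have [le|lt] := leP (scaled_count R S n k v om) (s ^+ k).
  by rewrite (le_trans le)// lerDl divr_ge0// ltW.
apply: (@le_trans _ _ (2 * collisions n k om / s ^+ k));
  last by rewrite lerDr ltW.
rewrite ler_pdivlMr// (le_trans _ (scaled_count_sqr_le n k v om))// expr2.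
by rewrite ler_wpM2l ?scaled_count_ge0// ltW.
Qed.

Lemma scaled_Z_expe_le (s : R) q n v om : 0 < s ->
  ((Z R S n v om * (n%:R^-1)%:E) ^+ q <=
   1 + \sum_(k <oo) (q%:R * k.+1%:R ^+ q *
         (s ^+ k + 2 * collisions n k om / s ^+ k))%:E)%E.
Proof.
move=> s0; rewrite scaled_ZE.
set z := fun k => scaled_count R S n k v om.
set g := fun k => q%:R * k.+1%:R ^+ q * (s ^+ k + 2 * collisions n k om / s ^+
  k).
have z01 k : 0 <= z k <= 1 by rewrite scaled_count_ge0 scaled_count_le1.
have zg k : q%:R * k.+1%:R ^+ q * z k <= g k.
  by rewrite ler_wpM2l ?mulr_ge0 ?exprn_ge0// scaled_count_le.
have z0 k : 0 <= z k by case/andP : (z01 k).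
have gz0 k : 0 <= g k by apply: le_trans (zg k); do 2 apply: mulr_ge0 => //;
  exact: exprn_ge0.
have cz : (\sum_(0 <= k < K) (z k)%:E)%E @[K --> \oo] --> (\sum_(k <oo) (z
  k)%:E)%E.
  by apply: is_cvg_nneseries => k _ _; rewrite lee_fin.
have Z0 : (0 <= \sum_(k <oo) (z k)%:E)%E.
  by apply: nneseries_ge0 => k _ _; rewrite lee_fin.
have H := @cvge_expe _ _ _ q Z0 cz.
rewrite -(cvg_lim _ H)//; apply: lime_le; first by apply/cvg_ex; eexists;
  exact: H.
apply: nearW => K; rewrite sumEFin big_mkord -EFin_expe.
apply: (@le_trans _ _ (1 + \sum_(k < K) g k)%:E).
  rewrite lee_fin (le_trans (expr_sum_le _ _ z01))// lerD2l.
  by apply: ler_sum => k _; exact: zg.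
rewrite EFinD leeD2l// -sumEFin -(big_mkord xpredT (fun k => (g k)%:E)).
by apply: nneseries_lim_ge => k _ _; rewrite lee_fin.
Qed.

End collisions.

Section random_prefix.
Context d (Om : measurableType d) (R : realType) (P : probability Om R).
Context (b : nat) (mu : 'I_b -> R) (p : 'I_b -> 'I_b -> R).
Hypothesis hpar : markov_parameters mu p.
Variable S : nat -> Om -> istr b.
Hypothesis hchain : forall i, markov_chain P mu p (S i).
Hypothesis hindep : independent_strings P S.

(** The string [V] is random, so the count is split according to the value of
   its prefix; each prefix contributes a count of fixed events. *)
Lemma measurable_scaled_Z (V : Om -> istr b) n :
  (forall k (w : k.-tuple 'I_b), measurable [set om | pref k (V om) = w]) ->
  measurable_fun setT (fun om => Z R S n (V om) om * (n%:R^-1)%:E)%E.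
Proof.
move=> mV; under eq_fun do rewrite scaled_ZE.
apply: ge0_emeasurable_sum => [k om _ _|k _];
  first by rewrite lee_fin scaled_count_ge0.
apply/measurable_EFinP.
pose f (w : k.-tuple 'I_b) om : R := \1_[set om | pref k (V om) = w] om *
  (\1_[set om | 2 <= hits R (cyl S w) n om] om * (hits R (cyl S w) n om /
    n%:R)).
rewrite (_ : (fun om => _) = (fun om => \sum_w f w om)); last first.
  apply/funext => om; rewrite (bigD1 (pref k (V om)))//= big1 ?addr0.
    rewrite /f indicE mem_set// mul1r scaled_countE indicE.
    case: ifPn => h; first by rewrite mem_set// mul1r.
    by rewrite memNset ?mul0r//; exact/negP.
  move=> w /negP wV; rewrite /f indicE memNset ?mul0r// => /= E.
  by apply: wV; rewrite E.
apply: measurable_sum => w.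
have mc := measurable_cyl hchain w.
apply: measurable_funM; first exact: measurable_indic.
apply: measurable_funM; first by apply: measurable_indic;
  exact: measurable_hits_ge.
by apply: measurable_funM => //; exact: measurable_hits.
Qed.

Lemma measurable_collisions n k : measurable_fun setT (collisions R S n k).
Proof.
apply: measurable_funM => //; apply: measurable_sum => w.
have mc := measurable_cyl hchain w.
have mh := measurable_hits mc n.
by apply: measurable_funM => //; exact: measurable_funB.
Qed.

Section constants.
Variables (r C : R).
Hypothesis r01 : 0 < r < 1.
Hypothesis C0 : 0 < C.
Hypothesis wtC : forall w : seq 'I_b,
  word_weight mu p w <= C * (r ^+ 16) ^+ size w.

Lemma integral_collisions_le n k :
  (\int[P]_om (collisions R S n k om)%:E <= (C * (r ^+ 16) ^+ k)%:E)%E.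
Proof.
have mc := measurable_cyl hchain.
rewrite /collisions; under eq_integral do rewrite EFinM muleC -sumEFin.
rewrite ge0_integralZl_EFin//; last first.
- apply: emeasurable_sum => w; apply/measurable_EFinP.
  have mh := measurable_hits (mc _ w) n.
  by apply: measurable_funM => //; exact: measurable_funB.
- by move=> om _; apply: sume_ge0 => w _; rewrite lee_fin hits_pairs_ge0.
rewrite ge0_integral_sum//; last first.
- by move=> w om _; rewrite lee_fin hits_pairs_ge0.
- move=> w; apply/measurable_EFinP.
  have mh := measurable_hits (mc _ w) n.
  by apply: measurable_funM => //; exact: measurable_funB.
under eq_bigr => w _ do
  rewrite (integral_hits_pairs (mc _ w) (cyl_law hchain w) (@cyl_indep _ _ _ _
    _ _ _ _ hchain hindep _ w)).
rewrite sumEFin -EFinM lee_fin -mulr_sumr.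
apply: le_trans (sum_wt_sqr_le hpar hchain wtC k).
rewrite mulrA ler_piMl ?sumr_ge0//; first by move=> w _; exact: sqr_ge0.
case: n => [|n]; first by rewrite mul0r mulr0.
by rewrite mulrC ler_pdivrMr ?exprn_gt0// mul1r expr2 ler_wpM2l// gerBl.
Qed.

(** With [s = r ^ 8] both [s ^ k] and the expectation of [collisions k / s ^ k]
   are at most a constant times [s ^ k], since collisions have expectation at
   most [C * s ^ (2 * k)]. *)
Lemma scaled_Z_moment_bound q : exists D : R, forall (V : Om -> istr b) n,
  (forall k (w : k.-tuple 'I_b), measurable [set om | pref k (V om) = w]) ->
  (\int[P]_om ((Z R S n (V om) om * (n%:R^-1)%:E) ^+ q) <= D%:E)%E.
Proof.
have /andP[r0 r1] := r01.
pose s := r ^+ 8.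
have s01 : 0 < s < 1 by rewrite exprn_gt0//= exprn_ilt1// ltW.
have /andP[s0 s1] := s01.
have [B [B0 HB]] := sum_poly_geometric_le q s01.
exists (1 + q%:R * (1 + 2 * C) * B) => V n mV.
pose g k om : R := q%:R * k.+1%:R ^+ q * (s ^+ k + 2 * collisions R S n k om /
  s ^+ k).
have c0 k om : 0 <= collisions R S n k om := collisions_ge0 R S n k om.
have sk0 k : 0 < s ^+ k by rewrite exprn_gt0.
have mcol := measurable_collisions n.
have g0 k om : 0 <= g k om.
  apply: mulr_ge0; first by rewrite mulr_ge0// exprn_ge0.
  by rewrite addr_ge0 ?(ltW (sk0 k))// divr_ge0 ?(ltW (sk0 k))// mulr_ge0.
have mg k : measurable_fun setT (g k).
  apply: measurable_funM => //; apply: measurable_funD => //.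
  by apply: measurable_funM => //; exact: measurable_funM.
apply: (@le_trans _ _ (\int[P]_om (1 + \sum_(k <oo) (g k om)%:E))%E).
  apply: ge0_le_integral => //.
  - by move=> om _; rewrite expe_ge0// scaled_ZE nneseries_ge0// => k _ _;
      rewrite lee_fin scaled_count_ge0.
  - by apply: measurable_fun_expe; exact: measurable_scaled_Z.
  - apply: emeasurable_funD => //; apply: ge0_emeasurable_sum => [k om _ _|k _].
      by rewrite lee_fin.
    exact/measurable_EFinP.
  - by move=> om _; exact: scaled_Z_expe_le.
rewrite ge0_integralD//; last first.
- apply: ge0_emeasurable_sum => [k om _ _|k _]; first by rewrite lee_fin.
  exact/measurable_EFinP.
- by move=> om _; apply: nneseries_ge0 => k _ _; rewrite lee_fin.
rewrite integral_cst//= probability_setT mule1 EFinD leeD2l//.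
rewrite integral_nneseries//; last first.
- by move=> k om _; rewrite lee_fin.
- by move=> k; exact/measurable_EFinP.
apply: nneseries_le_bound => [k|K].
  by apply: integral_ge0 => om _; rewrite lee_fin.
apply: (@le_trans _ _ (\sum_(0 <= k < K)
    (q%:R * (1 + 2 * C) * (k.+1%:R ^+ q * s ^+ k))%:E)%E); last first.
  rewrite sumEFin lee_fin -mulr_sumr big_mkord ler_wpM2l ?HB//.
  by rewrite mulr_ge0// addr_ge0// mulr_ge0// ltW.
apply: lee_sum => k _; rewrite /g.
have -> : (fun om => (q%:R * k.+1%:R ^+ q * (s ^+ k + 2 * collisions R S n k om
  / s ^+ k))%:E)
  = (fun om => (q%:R * k.+1%:R ^+ q * s ^+ k)%:E +
      (q%:R * k.+1%:R ^+ q * (2 / s ^+ k))%:E * (collisions R S n k om)%:E)%E.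
  by apply/funext => om; rewrite -EFinM -EFinD; congr EFin; ring.
have q0 : 0 <= q%:R * k.+1%:R ^+ q :> R by rewrite mulr_ge0// exprn_ge0.
have e0 : 0 <= q%:R * k.+1%:R ^+ q * (2 / s ^+ k) by rewrite mulr_ge0//
  divr_ge0// ltW.
rewrite ge0_integralD//; last first.
- by apply: measurable_funeM; exact/measurable_EFinP.
- by move=> om _; rewrite -EFinM lee_fin mulr_ge0.
- by move=> om _; rewrite lee_fin mulr_ge0// ltW.
rewrite integral_cst//= probability_setT mule1 ge0_integralZl_EFin//;
  last first.
- exact/measurable_EFinP.
- by move=> om _; rewrite lee_fin.
apply: (@le_trans _ _ ((q%:R * k.+1%:R ^+ q * s ^+ k)%:E +
    (q%:R * k.+1%:R ^+ q * (2 / s ^+ k))%:E * (C * (r ^+ 16) ^+ k)%:E)%E).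
  by rewrite leeD2l// lee_wpmul2l// ?lee_fin// integral_collisions_le.
have -> : (r ^+ 16) ^+ k = s ^+ k * s ^+ k.
  by rewrite /s -exprD -exprM -exprM; congr (r ^+ _);
    rewrite mulnDr addnn -mul2n mulnA.
rewrite -EFinM -EFinD lee_fin le_eqVlt; apply/orP; left; apply/eqP.
by field; rewrite gt_eqF.
Qed.

End constants.

End random_prefix.

(** * The limit theorem for random strings *)

Section random_string_limit.
Context d (Om : measurableType d) (R : realType) (P : probability Om R).
Context (b : nat) (mu : 'I_b -> R) (p : 'I_b -> 'I_b -> R).
Hypothesis hpar : markov_parameters mu p.
Variable S : nat -> Om -> istr b.
Hypothesis hchain : forall i, markov_chain P mu p (S i).
Hypothesis hindep : independent_strings P S.

Lemma prefix_mass_ge0 (v : istr b) : (0 <= prefix_mass mu p v)%E.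
Proof.
rewrite prefix_massE//; apply: nneseries_ge0 => k _ _.
by rewrite lee_fin ltW// word_weight_gt0.
Qed.

Lemma prefix_mass_fin_num (v : istr b) : prefix_mass mu p v \is a fin_num.
Proof.
rewrite ge0_fin_numE ?prefix_mass_ge0// prefix_massE//.
have [r [C [/andP[r0 r1] C0 wtC]]] := word_weight_geometric hpar.
have s01 : 0 < r ^+ 16 < 1 by rewrite exprn_gt0//= exprn_ilt1// ltW.
apply: (@le_lt_trans _ _ (C / (1 - r ^+ 16))%:E); last exact: ltry.
apply: nneseries_le_bound => [k|K];
  first by rewrite lee_fin ltW// word_weight_gt0.
rewrite sumEFin lee_fin big_mkord.
apply: le_trans (sum_geometric_le K s01 (ltW C0)).
by apply: ler_sum => k _; rewrite (le_trans (wtC _))// size_tuple.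
Qed.

(** The sequences of both parts of the theorem are random strings [V n] agreeing
   with a fixed string on longer and longer prefixes; as the tail estimate is
   uniform over all words, [V n] may depend on the sample. *)
Lemma random_string_cvg (V : nat -> Om -> istr b) (v : istr b) :
  (forall n k (w : k.-tuple 'I_b), measurable [set om | pref k (V n om) = w]) ->
  {ae P, forall om, forall k, \forall n \near \oo, agree k (V n om) v} ->
  cvg_as_and_moments P (fun n om => Z R S n (V n om) om * (n%:R^-1)%:E)%E
    (prefix_mass mu p v).
Proof.
move=> mV Vv.
have [r [C [r01 C0 wtC]]] := word_weight_geometric hpar.
have [K [K0 tail]] := ae_geometric_tail hpar hchain hindep r01 C0 wtC.
have /andP[r0 r1] := r01.
have r201 : 0 < r ^+ 2 < 1 by rewrite exprn_gt0//= exprn_ilt1// ltW.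
have as_cvg : {ae P, forall om, (Z R S n (V n om) om * (n%:R^-1)%:E)%E
    @[n --> \oo] --> prefix_mass mu p v}.
  apply: filterS3 (ae_word_averages hchain hindep) tail Vv => om avg tl ag.
  exact: (scaled_Z_cvg hpar K0 r201 avg tl ag).
split=> // q.
rewrite -(fineK (prefix_mass_fin_num v)) in as_cvg *.
apply: moments_cvg => //.
- by rewrite fine_ge0// prefix_mass_ge0.
- by move=> n; exact: measurable_scaled_Z.
- move=> n om; rewrite scaled_ZE; apply: nneseries_ge0 => k _ _.
  by rewrite lee_fin scaled_count_ge0.
- move=> q'; have [D HD] := scaled_Z_moment_bound hpar hchain hindep r01 C0 wtC
    q'.
  by exists D => n; exact: HD.
Qed.

End random_string_limit.

(** * The quantile string *)

Section zero_tails.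
Context (b : nat) (z : 'I_b).
Hypothesis z0 : z = 0%N :> nat.
Implicit Types (g v w : istr b).

(** A string whose letters from position [k] on are all zero is the smallest one
   with its prefix of length [k], so whether another string is below it is
   decided by [k] letters. *)
Definition zero_from k g := forall l, (k <= l)%N -> g l = z.

Definition upd g k (r : 'I_b) : istr b := fun l => if l == k then r else g l.

Definition cut v k : istr b := fun l => if (l < k)%N then v l else z.

Lemma zero_from_ext k (w : k.-tuple 'I_b) : zero_from k (ext z w).
Proof. by move=> l kl; rewrite /ext nth_default// size_tuple. Qed.

Lemma zero_from_cut v k : zero_from k (cut v k).
Proof. by move=> l kl; rewrite /cut ltnNge kl. Qed.

Lemma zero_from_upd g k r : zero_from k g -> zero_from k.+1 (upd g k r).
Proof. by move=> gk l kl; rewrite /upd gtn_eqF// gk// ltnW. Qed.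

Lemma agree_cut v k : agree k (cut v k) v.
Proof. by move=> l lk; rewrite /cut lk. Qed.

Lemma agree_upd g k r : agree k (upd g k r) g.
Proof. by move=> l lk; rewrite /upd ltn_eqF. Qed.

Lemma upd_same g k r : upd g k r k = r.
Proof. by rewrite /upd eqxx. Qed.

Lemma zero_from_min k g v : zero_from k g -> agree k v g -> ~ lex_lt v g.
Proof.
move=> gk vg /lex_ltP[i _ lt].
have [ik|ki] := ltnP i k; first by rewrite vg// ltnn in lt.
by rewrite gk// z0 ltn0 in lt.
Qed.

Lemma lex_lt_agree k g v w : zero_from k g -> agree k v w ->
  lex_lt v g -> lex_lt w g.
Proof.
move=> gk vw /lex_ltP[i ag lt]; apply/lex_ltP.
have ik : (i < k)%N by rewrite ltnNge; apply/negP => ki;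
  rewrite gk// z0 ltn0 in lt.
exists i; last by rewrite -vw.
by apply: agree_trans ag; apply: agree_sym; apply: agree_le (ltnW ik) vw.
Qed.

Lemma Sigma0_zero_from k g l : zero_from k g -> g l != 0%N :> nat -> Sigma0 g.
Proof.
move=> gk gl; split; last by exists l.
apply: (@sub_finite_set _ _ `I_k); last exact: finite_II.
move=> i /= /eqP gi; rewrite ltnNge; apply/negP => ki; apply: gi.
by rewrite gk.
Qed.

End zero_tails.

Section quantile.
Context d (Om : measurableType d) (R : realType) (P : probability Om R).
Context (b : nat) (hb : (1 < b)%N) (mu : 'I_b -> R) (p : 'I_b -> 'I_b -> R).
Hypothesis hpar : markov_parameters mu p.
Variable X : Om -> istr b.
Hypothesis hX : markov_chain P mu p X.

Local Notation z := (zero_letter hb).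
Local Notation F := (string_cdf P X).

Let z0 : z = 0%N :> nat. Proof. by []. Qed.

Definition prefix_determined k (Q : istr b ->
  Prop) := forall v w, agree k v w -> Q v -> Q w.

Lemma prefix_determinedE k Q v : prefix_determined k Q ->
  Q v <-> `[< Q (ext z (pref k v)) >].
Proof.
move=> lQ; have ag : agree k v (ext z (pref k v)).
  by apply/pref_agree; rewrite pref_ext.
split=> [Qv|/asboolP]; first by apply/asboolP; exact: lQ ag Qv.
by apply: lQ; exact: agree_sym.
Qed.

Lemma measurable_prefix_determined k Q : prefix_determined k Q ->
  measurable [set om | Q (X om)].
Proof.
move=> lQ; rewrite (_ : [set _ | _] =
  [set om | (fun w : k.-tuple 'I_b => `[< Q (ext z w) >]) (pref k (X om))]).
  exact: (measurable_pref hX (fun w : k.-tuple 'I_b => `[< Q (ext z w) >])).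
by apply/seteqP; split=> om /=;
  rewrite (propext (prefix_determinedE (X om) lQ)).
Qed.

Lemma prefix_determined_lex_lt k g : zero_from z k g ->
  prefix_determined k (fun v => lex_lt v g).
Proof. by move=> gk v w; exact: (lex_lt_agree z0 gk). Qed.

Lemma prefix_determined_agree k g : prefix_determined k (fun v => agree k v g).
Proof. by move=> v w vw vg; apply: agree_trans vg; exact: agree_sym. Qed.

Lemma measurable_lex_lt w : measurable [set om | lex_lt (X om) w].
Proof.
rewrite (_ : [set _ | _] =
  \bigcup_i [set om | agree i (X om) w /\ (X om i < w i)%N]); last first.
  apply/seteqP; split=> [om /lex_ltP[i ag lt]|om [i _ [ag lt]]];
    first by exists i.
  by apply/lex_ltP; exists i.
apply: bigcup_measurable => i _;
  apply: (measurable_prefix_determined (k := i.+1) (Q := fun v =>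
  agree i v w /\ (v i < w i)%N)).
move=> u v uv [ag lt]; split; last by rewrite -uv.
by apply: agree_trans ag; apply: agree_sym; apply: agree_le (leqnSn i) uv.
Qed.

Lemma measurable_eq_string w : measurable [set om | X om = w].
Proof.
rewrite (_ : [set _ | _] = \bigcap_k [set om | agree k (X om) w]).
  by apply: bigcapT_measurable => k;
    exact: (measurable_prefix_determined (@prefix_determined_agree k w)).
apply/seteqP; split=> [om E k _ /=|om H /=]; first by rewrite E.
by apply/funext => k; exact: (H k.+1 I).
Qed.

Lemma measurable_lex_le w : measurable [set om | lex_le (X om) w].
Proof.
apply: measurableU; first exact: measurable_lex_lt.
exact: measurable_eq_string.
Qed.

Lemma string_cdfE w : (F w)%:E = P [set om | lex_le (X om) w].
Proof.
by rewrite /string_cdf fineK// fin_num_measure//; exact: measurable_lex_le.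
Qed.

Lemma string_cdf_mono v w : lex_le v w -> F v <= F w.
Proof.
move=> vw; rewrite -lee_fin !string_cdfE; apply: le_measure.
- by rewrite inE; exact: measurable_lex_le.
- by rewrite inE; exact: measurable_lex_le.
- by move=> om /= Xv; exact: lex_le_trans vw.
Qed.

(** By the geometric decay of the weights; the distribution function of the
   source is continuous for this reason. *)
Lemma small_cylinders (e : R) v : 0 < e ->
  exists k, (P [set om | agree k (X om) v] <= e%:E)%E.
Proof.
move=> e0; have [r [C [/andP[r0 r1] C0 wtC]]] := word_weight_geometric hpar.
have s1 : `|r ^+ 16| < 1.
  by rewrite ger0_norm ?exprn_ge0 ?exprn_ilt1// ltW.
have /cvgrPdist_le /(_ _ e0) [k _ /(_ k (leqnn k))] := @cvg_geometric R C _ s1.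
rewrite sub0r normrN /= => h; exists k.
rewrite (_ : [set _ | _] = [set om | pref k (X om) = pref k v]); last first.
  by apply/seteqP; split=> om /=; rewrite pref_agree.
rewrite (cylinder_law hX) lee_fin (le_trans (wtC _))// size_tuple.
by rewrite (le_trans _ h)// ler_norm.
Qed.

Lemma prob_eq_string v : P [set om | X om = v] = 0%E.
Proof.
apply/eqP; rewrite eq_le measure_ge0 andbT; apply/lee_addgt0Pr => e e0.
rewrite add0e; have [k] := small_cylinders v e0; apply: le_trans.
apply: le_measure; rewrite ?inE.
- exact: measurable_eq_string.
- exact: (measurable_prefix_determined (@prefix_determined_agree k _)).
- by move=> om /= ->.
Qed.

Lemma string_cdf_lt w : (F w)%:E = P [set om | lex_lt (X om) w].
Proof.
rewrite string_cdfE.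
rewrite (_ : [set om | _] = [set om | lex_lt (X om) w] `|` [set om | X om =
  w])//.
rewrite [LHS]measureU0//; first exact: measurable_lex_lt.
- exact: measurable_eq_string.
- exact: prob_eq_string.
Qed.

Section greedy.
Variable t : R.
Hypothesis t01 : 0 <= t.

(** Choosing every letter as large as the distribution function allows builds
   the largest string [v] with [F v <= t]. *)
Let pick (g : istr b) k : 'I_b := [arg max_(r > z | F (upd g k r) <= t) (r :
  nat)].

Let hs := fix hs k : istr b :=
  if k is k'.+1 then upd (hs k') k' (pick (hs k') k') else fun=> z.

Definition greedy : istr b := fun k => hs k.+1 k.

Let hs_zero k : zero_from z k (hs k).
Proof. by elim: k => [//|k IH] /=; exact: zero_from_upd. Qed.

Let F_zero : F (fun=> z) <= t.
Proof.
apply: le_trans t01; rewrite -lee_fin string_cdf_lt.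
rewrite (_ : [set _ | _] = set0) ?measure0//.
by apply/seteqP; split=> // om /=; apply: (zero_from_min z0 (k := 0)).
Qed.

Let upd_zero k : upd (hs k) k z = hs k.
Proof.
by apply/funext => l; rewrite /upd; case: eqP => // ->;
  rewrite (hs_zero (leqnn k)).
Qed.

Let hs_le k : F (hs k) <= t.
Proof.
elim: k => [|k IH] //=; rewrite /pick; case: arg_maxnP => //.
by rewrite upd_zero.
Qed.

Let cut_greedy k : cut z greedy k = hs k.
Proof.
apply/funext => l; rewrite /cut; case: ltnP => [lk|kl]; last by rewrite hs_zero.
rewrite /greedy; elim: k lk => [//|k IH];
  rewrite ltnS leq_eqVlt => /orP[/eqP ->//|lk].
by rewrite IH//= /upd ltn_eqF.
Qed.

Lemma cdf_cut_greedy k : F (cut z greedy k) <= t.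
Proof. by rewrite cut_greedy. Qed.

(** Maximality of the chosen letter. *)
Lemma cdf_upd_greedy i (r : 'I_b) : (greedy i < r)%N ->
  t < F (upd (cut z greedy i) i r).
Proof.
rewrite cut_greedy {1}/greedy /= upd_same /pick.
case: arg_maxnP => [|r' _ rmax]; first by rewrite upd_zero.
by move=> r'r; rewrite ltNge; apply/negP => /rmax; rewrite /= leqNgt r'r.
Qed.

(** A sample string below [greedy] either branches off before position [k], and
   is then below the prefix of length [k] continued by zeros, or shares this
   prefix, which is an event of small probability. *)
Lemma cdf_greedy : F greedy <= t.
Proof.
apply/ler_addgt0Pr => e e0; have [k hk] := small_cylinders greedy e0.
apply: (@le_trans _ _ (F (cut z greedy k) + e));
  last by rewrite lerD2r cdf_cut_greedy.
rewrite -lee_fin EFinD !string_cdfE; apply: le_trans (leeD2l _ hk).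
have mA : measurable [set om | agree k (X om) greedy].
  exact: (measurable_prefix_determined (@prefix_determined_agree k _)).
have mB := measurable_lex_le (cut z greedy k).
apply: le_trans (measureU2 _ _ _) => //.
apply: le_measure; rewrite ?inE; first exact: measurable_lex_le.
  exact: measurableU.
move=> om /= [|->]; last by right.
move=> /lex_ltP[i ag lt]; have [ik|ki] := ltnP i k.
  left; left; apply/lex_ltP; exists i; last by rewrite agree_cut.
  apply: agree_trans ag _; apply: agree_sym; apply: agree_le (ltnW ik) _.
  exact: agree_cut.
by right; exact: agree_le ki ag.
Qed.

(** A string above [greedy] is at least the string of [cdf_upd_greedy] that
   branches off at the first difference, so its value exceeds [t]. *)
Lemma lex_lub_greedy : lex_lub [set v | F v <= t] greedy.
Proof.
split=> [v /= Fv|u]; last by apply; exact: cdf_greedy.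
apply/lex_leNgt => /lex_ltP[i ag lt].
have := cdf_upd_greedy lt; rewrite ltNge => /negP; apply.
apply: le_trans Fv; apply: string_cdf_mono; apply/lex_leNgt.
apply: (zero_from_min z0 (k := i.+1)).
  by apply: zero_from_upd; exact: zero_from_cut.
apply/agreeS; rewrite upd_same; split=> //.
apply: agree_trans (agree_sym ag) _; apply: agree_sym.
by apply: (@agree_trans _ _ _ (cut z greedy i));
  [exact: agree_upd|exact: agree_cut].
Qed.

Lemma string_quantileE : string_quantile P hb X t = greedy.
Proof.
rewrite /string_quantile /lex_sup; case: xgetP => [u _ [ub lub]|/(_ greedy) []].
  have [gub glub] := lex_lub_greedy.
  by apply: lex_le_anti; [exact: lub|exact: glub].
exact: lex_lub_greedy.
Qed.

End greedy.

End quantile.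

(** * Prefixes of order statistics *)

Section order_statistic_limit.
Context d (Om : measurableType d) (R : realType) (P : probability Om R).
Context (b : nat) (hb : (1 < b)%N) (mu : 'I_b -> R) (p : 'I_b -> 'I_b -> R).
Hypothesis hpar : markov_parameters mu p.
Variable S : nat -> Om -> istr b.
Hypothesis hchain : forall i, markov_chain P mu p (S i).

Local Notation z := (zero_letter hb).
Local Notation F := (string_cdf P (S 0%N)).

Let z0 : z = 0%N :> nat. Proof. by []. Qed.

Lemma hits_sum_nat (D : set (istr b)) n om :
  hits R (fun i => [set om | D (S i om)]) n om =
  (\sum_(i < n) (S i om \in D))%:R.
Proof. by rewrite hits_nat. Qed.

Lemma empirical_cdf_cvg g k om : zero_from z k g ->
  (forall k (w : k.-tuple 'I_b),
    hits R (cyl S w) n om / n%:R @[n --> \oo] --> word_weight mu p w) ->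
  hits R (fun i => [set om | lex_lt (S i om) g]) n om / n%:R @[n --> \oo] --> F
    g.
Proof.
move=> gk avg.
pose D := fun w : k.-tuple 'I_b => `[< lex_lt (ext z w) g >].
have ltE v : lex_lt v g <-> D (pref k v).
  exact: prefix_determinedE (prefix_determined_lex_lt gk).
have -> : F g = \sum_(w | D w) word_weight mu p w.
  apply/EFin_inj; rewrite (string_cdf_lt hb hpar (hchain 0%N)).
  rewrite -(pref_law (hchain 0%N)); congr (P _).
  by apply/seteqP; split=> om' /=; rewrite (propext (ltE _)).
have E n : hits R (fun i => [set om | lex_lt (S i om) g]) n om / n%:R =
    \sum_(w | D w) (hits R (cyl S w) n om / n%:R).
  rewrite -mulr_suml; congr (_ / _); rewrite /hits exchange_big/=.
  apply: eq_bigr => i _; rewrite indicE.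
  have [Dw|nD] := boolP (D (pref k (S i om))).
    rewrite (bigD1 (pref k (S i om)))//= indicE big1 ?addr0; last first.
      move=> w /andP[_ /eqP wS]; rewrite indicE memNset// => /= Ew.
      by apply: wS; rewrite Ew.
    by rewrite !mem_set//=; apply/ltE.
  rewrite big1; last first.
    move=> w Dw; rewrite indicE memNset// => /= Ew.
    by move: nD; rewrite Ew Dw.
  by rewrite memNset// => /= /ltE; exact/negP.
under eq_fun do rewrite E.
by apply: cvg_big => [|w _]; [exact: add_continuous|exact: avg].
Qed.

(** The sets of strings below [g], and of those below [g] or starting with the
   word of [g], are closed downwards and decided by [k] letters, so that both
   events reduce to counts of sample strings; the prefix event is their
   difference. *)
Lemma measurable_order_stat n l k (w : k.-tuple 'I_b) : (n = 0 \/ 1 <= l <=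
  n)%N ->
  measurable [set om | pref k (order_stat S n l om) = w].
Proof.
case=> [->|ln].
  rewrite (_ : [set _ | _] = [set om | pref k (S 0%N om) = w]).
    exact: (measurable_cylinder (hchain 0%N)).
  by apply/seteqP; split=> om /=; rewrite /order_stat /= nth_nil.
pose g := ext z w.
have gk : zero_from z k g by exact: zero_from_ext.
pose D1 : set (istr b) := [set v | lex_lt v g].
pose D2 : set (istr b) := [set v | lex_lt v g \/ agree k v g].
have down1 v v' : lex_le v v' -> D1 v' -> D1 v by exact: lex_le_lt_trans.
have down2 v v' : lex_le v v' -> D2 v' -> D2 v.
  move=> vv [lt|ag]; first by left; exact: lex_le_lt_trans lt.
  case: vv => [/lex_ltP[i vi lt]|->]; last by right.
  have [ik|ki] := ltnP i k; last by right; apply: agree_trans ag;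
    exact: agree_le vi.
  left; apply/lex_ltP; exists i; last by rewrite -(ag i ik).
  by apply: agree_trans vi _; exact: agree_le (ltnW ik) ag.
have mD (D : set (istr b)) : (forall v v', lex_le v v' -> D v' -> D v) ->
    prefix_determined k D -> measurable [set om | D (order_stat S n l om)].
  move=> down lD.
  rewrite (_ : [set _ | _] = [set om | l%:R <=
      hits R (fun i => [set om | D (S i om)]) n om]).
    apply: measurable_hits_ge => i;
      exact: (measurable_prefix_determined hb (hchain i) lD).
  apply/seteqP; split=> om /=; rewrite hits_sum_nat ler_nat.
    by move/(@order_stat_down _ _ S D n l om down ln).
  by move=> h; apply/(@order_stat_down _ _ S D n l om down ln).
have l1 : prefix_determined k D1 by exact: prefix_determined_lex_lt.
have l2 : prefix_determined k D2.
  move=> v v' vv [lt|ag]; first by left;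
    exact: (prefix_determined_lex_lt gk) vv lt.
  by right; exact: (prefix_determined_agree vv ag).
rewrite (_ : [set _ | _] = [set om | D2 (order_stat S n l om)] `\`
  [set om | D1 (order_stat S n l om)]).
  by apply: measurableD; exact: mD.
apply/seteqP; split=> om /=.
  move=> E; have ag : agree k (order_stat S n l om) g.
    by apply/pref_agree; rewrite pref_ext.
  by split; [right|exact: (zero_from_min z0 gk ag)].
by move=> [[//|/pref_agree E] _]; rewrite E pref_ext.
Qed.

(** A disagreement at position [i] would put the string of rank [k n] on the
   wrong side of one of finitely many thresholds that vanish after position [i].
   The thresholds above have values greater than [t] by the choice of the
   letters; those below have values at most [t], and different from [t] because
   they lie in [Sigma0]. *)
Lemma order_stat_agree (k : nat -> nat) (t : R) om :
  (forall n, (1 <= n)%N -> (1 <= k n <= n)%N) -> 0 <= t ->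
  ~ (F @` @Sigma0 b) t ->
  (k n)%:R / n%:R @[n --> \oo] --> t ->
  (forall k (w : k.-tuple 'I_b),
    hits R (cyl S w) n om / n%:R @[n --> \oo] --> word_weight mu p w) ->
  forall K, \forall n \near \oo,
    agree K (order_stat S n (k n) om) (string_quantile P hb (S 0%N) t).
Proof.
move=> kn t0 tS kt avg; rewrite (string_quantileE hb hpar (hchain 0%N) t0).
set h := greedy _ _ _ _.
have n0 : \forall n \near \oo, (1 <= n)%N by exists 1%N.
(* The sample has asymptotically [n * F g] strings below [g], to be compared
   with the rank [k n], which is asymptotically [n * t]. *)
have rank_lt j g : zero_from z j g -> F g < t ->
    \forall n \near \oo, ~ lex_lt (order_stat S n (k n) om) g.
  move=> gj gt; pose m := (F g + t) / 2.
  have Fm : F g < m by rewrite /m; lra.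
  have mt : m < t by rewrite /m; lra.
  have /cvgr_lt /(_ _ Fm) h1 := @empirical_cdf_cvg g j om gj avg.
  have /cvgr_gt /(_ _ mt) h2 := kt.
  apply: filterS3 h1 h2 n0 => n h1 h2 n1 lt.
  have : (k n <= \sum_(i < n) (S i om \in [set v | lex_lt v g]))%N.
    apply/(@order_stat_down _ _ S [set v | lex_lt v g]) => //; last exact: kn.
    by move=> v v'; exact: lex_le_lt_trans.
  rewrite -(ler_nat R) -(hits_sum_nat [set v | lex_lt v g]) leNgt => /negP;
    apply.
  have nR : 0 < n%:R^-1 :> R by rewrite invr_gt0 ltr0n.
  by rewrite -(ltr_pM2r nR) (lt_trans h1).
have rank_gt j g : zero_from z j g -> t < F g ->
    \forall n \near \oo, lex_lt (order_stat S n (k n) om) g.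
  move=> gj tg; pose m := (F g + t) / 2.
  have Fm : m < F g by rewrite /m; lra.
  have mt : t < m by rewrite /m; lra.
  have /cvgr_gt /(_ _ Fm) h1 := @empirical_cdf_cvg g j om gj avg.
  have /cvgr_lt /(_ _ mt) h2 := kt.
  apply: filterS3 h1 h2 n0 => n h1 h2 n1.
  apply/(@order_stat_down _ _ S [set v | lex_lt v g]) => //.
  - by move=> v v'; exact: lex_le_lt_trans.
  - exact: kn.
  rewrite -(ler_nat R) -(hits_sum_nat [set v | lex_lt v g]) ltW//.
  have nR : 0 < n%:R^-1 :> R by rewrite invr_gt0 ltr0n.
  by rewrite -(ltr_pM2r nR) (lt_trans h2).
elim=> [|i IH]; first by apply: nearW => n l.
have not_below : \forall n \near \oo,
  ~ lex_lt (order_stat S n (k n) om) (cut z h i.+1)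
    \/ h i = 0%N :> nat.
  have [hi0|hi] := eqVneq (h i : nat) 0%N; first by apply: nearW => n; right.
  have ci : zero_from z i.+1 (cut z h i.+1) by exact: zero_from_cut.
  have : F (cut z h i.+1) < t.
    rewrite lt_neqAle (cdf_cut_greedy hb hpar (hchain 0%N) t0) andbT;
      apply/eqP => Ft; apply: tS.
    exists (cut z h i.+1) => //; apply: (Sigma0_zero_from z0 ci (l := i)).
    by rewrite /cut ltnSn.
  by move=> /(rank_lt _ _ ci); apply: filterS => n; left.
have not_above : \forall n \near \oo, forall r : 'I_b, (h i < r)%N ->
    lex_lt (order_stat S n (k n) om) (upd (cut z h i) i r).
  apply: filter_forall => r; have [hr|rh] := ltnP (h i) r; last first.
    by apply: nearW => n.
  have ui : zero_from z i.+1 (upd (cut z h i) i r).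
    by apply: zero_from_upd; exact: zero_from_cut.
  by apply: filterS (rank_gt _ _ ui (cdf_upd_greedy hpar (hchain 0%N) t0 hr))
    => n.
apply: filterS3 IH not_below not_above => n ag lo hi.
apply/agreeS; split=> //; set v := order_stat _ _ _ _ in ag lo hi *.
apply/eqP; rewrite -val_eqE eqn_leq; apply/andP; split; rewrite leqNgt;
  apply/negP => lt.
- apply: (zero_from_min z0 (k := i.+1)) (hi (v i) lt).
    by apply: zero_from_upd; exact: zero_from_cut.
  apply/agreeS; rewrite upd_same; split=> //.
  apply: (agree_trans ag); apply: agree_sym.
  by apply: (@agree_trans _ _ _ (cut z h i));
    [exact: agree_upd|exact: agree_cut].
- case: lo => [|hi0]; last by rewrite /= hi0 in lt.
  apply; apply/lex_ltP; exists i; last by rewrite /cut ltnSn.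
  apply: (agree_trans ag); apply: agree_sym; apply: (@agree_le _ _ i.+1) => //.
  exact: agree_cut.
Qed.

End order_statistic_limit.

(** * The limit theorem for Radix Selection *)

Theorem theorem1p1 (R : realType) (d : measure_display)
    (Om : measurableType d) (P : probability Om R)
    (b : nat) (hb : (1 < b)%N)
    (mu : 'I_b -> R) (p : 'I_b -> 'I_b -> R)
    (hpar : markov_parameters mu p)
    (S : nat -> Om -> istr b)
    (hchain : forall i, markov_chain P mu p (S i))
    (hindep : independent_strings P S) :
  (forall (v : istr b) (vs : nat -> istr b),
     len_to_infty (fun n => lcp (vs n) v) ->
     cvg_as_and_moments P
       (fun n om => (Z R S n (vs n) om * (n%:R^-1)%:E)%E)
       (prefix_mass mu p v)) /\
  (forall (k : nat -> nat) (t : R),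
     (forall n, (1 <= n)%N -> (1 <= k n <= n)%N) ->
     0 <= t <= 1 ->
     ~ (string_cdf P (S 0%N) @` @Sigma0 b) t ->
     (k n)%:R / n%:R @[n --> \oo] --> t ->
     cvg_as_and_moments P
       (fun n om => (Y R S n (k n) om * (n%:R^-1)%:E)%E)
       (prefix_mass mu p (string_quantile P hb (S 0%N) t))).
Proof.
split=> [v vs hv|k t kn /andP[t0 _] tS kt].
- apply: (random_string_cvg hpar hchain hindep (V := fun n _ => vs n)).
  + move=> n j w; have [<-|nE] := pselect (pref j (vs n) = w).
      by rewrite (_ : [set _ | _] = setT)//; apply/seteqP; split.
    by rewrite (_ : [set _ | _] = set0)//; apply/seteqP; split.
  + apply: aeW => om j; apply: filterS (hv j) => n; by move/lcp_spec.
- apply: (random_string_cvg hpar hchain hindep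
    (V := fun n om => order_stat S n (k n) om)).
  + move=> n j w; apply: measurable_order_stat => //.
    by case: n => [|n]; [left|right; exact: kn].
  + apply: filterS (ae_word_averages hchain hindep) => om avg.
    exact: (order_stat_agree hb hpar hchain kn t0 tS kt avg).
Qed.
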